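(* Suppose that $n$ is odd and that $S\subsetneq\{1,2,\dots,n\}$. Then the iterate $T^{n+1}$ of the pentagram map on $\mathcal{P}_n$ is nonsingular for generic $A\in X_S$.
   Context: $\overleftrightarrow{PQ}$ is the line through $P,Q$. Work in the real projective plane. A twisted $n$-gon is a sequence $A=(A_i)$ of points, indexed either by $\mathbb{Z}$ or by $\frac12+\mathbb{Z}$, such that $A_{i+n}=\phi(A_i)$ for all $i$ for some projective transformation $\phi$, and such that every four consecutive points are in general position. $A$ and $B$ are projectively equivalent if $\psi(A_i)=B_i$ for all $i$ for some projective transformation $\psi$. $\mathcal{P}_n$ (resp. $\mathcal{P}_n^*$) is the space of twisted $n$-gons indexed by $\mathbb{Z}$ (resp. by $\frac12+\mathbb{Z}$) modulo projective equivalence. Coordinates: $[a,b,c,d]=\frac{(a-b)(c-d)}{(b-c)(d-a)}$ is the cross ratio (of collinear points) and $\chi(a,b,c,d)=[b,a,c,d]$. For each index $k$ of $A$, $x_{2k}(A)=\chi(A_{k-2},A_{k-1},B,D)$ and $x_{2k+1}(A)=\chi(A_{k+2},A_{k+1},C,D)$, where $B=\overleftrightarrow{A_{k-2}A_{k-1}}\cap\overleftrightarrow{A_kA_{k+1}}$, $C=\overleftrightarrow{A_{k-1}A_k}\cap\overleftrightarrow{A_{k+1}A_{k+2}}$, $D=\overleftrightarrow{A_{k-2}A_{k-1}}\cap\overleftrightarrow{A_{k+1}A_{k+2}}$. Then $x_{j+2n}=x_j$, and $x_1,\dots,x_{2n}$ are (generically defined) coordinates on $\mathcal{P}_n$ and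 on $\mathcal{P}_n^*$. On $\mathcal{P}_n$ set $y_j=-(x_jx_{j+1})^{-1}$ for $j$ even and $y_j=-x_jx_{j+1}$ for $j$ odd. Pentagram map: $T$ sends $A$ to $B$ with $B_i=\overleftrightarrow{A_{i-3/2}A_{i+1/2}}\cap\overleftrightarrow{A_{i-1/2}A_{i+3/2}}$, giving rational maps $\mathcal{P}_n\to\mathcal{P}_n^*$ and $\mathcal{P}_n^*\to\mathcal{P}_n$. In coordinates, on $\mathcal{P}_n$: $x_j(T(A))=x_{j+1}\frac{1-x_{j+3}x_{j+2}}{1-x_{j-1}x_{j-2}}$ for $j$ even and $x_j(T(A))=x_{j-1}\frac{1-x_{j-3}x_{j-2}}{1-x_{j+1}x_{j+2}}$ for $j$ odd; on $\mathcal{P}_n^*$ the same with the words even and odd interchanged. $T^k$ denotes the $k$-fold iterate as a rational map on $\mathcal{P}_n$; it is singular at a point where it is not defined (regular), and nonsingular otherwise. ''Generic $A\in X$'' means $A$ in some dense (Zariski) open subset of $X$. For $i\in\mathbb{Z}$, $X_i=\{A\in\mathcal{P}_n: y_{2i}(A)=-1\}$, and for $S\subseteq\mathbb{Z}$, $X_S=\bigcap_{i\in S}X_i$. *)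

(* Defs.v *)
From HB Require Import structures.
From mathcomp Require Import all_boot all_order all_algebra.
From mathcomp Require Import boolp classical_sets reals.
From mathcomp Require Import mpoly.

Set Implicit Arguments.
Unset Strict Implicit.
Unset Printing Implicit Defensive.

Import Order.TTheory GRing.Theory Num.Theory.
Local Open Scope ring_scope.

(* The real projective plane is the set of lines of R^3: a point is a subspace
   of dimension 1, the line through P and Q is P + Q, and the intersection of
   two lines is their intersection :&: as subspaces.

   Sequences are indexed by DOUBLED indices, so that integer and half-integer
   indices are treated uniformly: the entry at m : int is the point A_{m/2}.
   A sequence indexed by Z uses the even m (parity false), one indexed by
   1/2 + Z uses the odd m (parity true); entries at indices of the other parity
   are never looked at. *)
Notation ptseq R := (int -> {vspace 'rV[R]_3}).

Definition has_parity (e : bool) (m : int) : bool := odd `|m|%N == e.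

Section Polygons.
Context {R : realType}.
Implicit Types (P Q : {vspace 'rV[R]_3}) (A B : ptseq R) (e : bool).

Definition is_point P : bool := \dim P == 1%N.

Definition noncollinear P1 P2 P3 : bool := (P1 + P2 + P3 == fullv)%VS.

Definition line P Q : {vspace 'rV[R]_3} := (P + Q)%VS.

Definition meet (L M : {vspace 'rV[R]_3}) : {vspace 'rV[R]_3} := (L :&: M)%VS.

Definition general_position4 P1 P2 P3 P4 : bool :=
  [&& noncollinear P1 P2 P3, noncollinear P1 P2 P4,
      noncollinear P1 P3 P4 & noncollinear P2 P3 P4].

(* Projective transformations are the maps P |-> (phi @: P)%VS for phi an
   invertible linear map. *)
Definition twisted_ngon (n : nat) e A : Prop :=
  [/\ forall m, has_parity e m -> is_point (A m),
      exists phi : 'End('rV[R]_3), lker phi = 0%VS /\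
        forall m, has_parity e m -> A (m + (2 * n)%:Z) = (phi @: A m)%VS
    & forall m, has_parity e m ->
        general_position4 (A m) (A (m + 2)) (A (m + 4)) (A (m + 6))].

Definition proj_equiv e A B : Prop :=
  exists phi : 'End('rV[R]_3), lker phi = 0%VS /\
    forall m, has_parity e m -> (phi @: A m)%VS = B m.

(* For collinear points, (a-b)(c-d) / ((b-c)(d-a)) in homogeneous coordinates:
   the difference p - q of two values of an affine coordinate of the line is
   replaced by the bracket det(p, q, o), where p, q are representative vectors
   and o is a fixed vector outside the plane of R^3 that the line is.  The
   choices of representatives and of o cancel out. *)
Definition cross_ratio (a b c d : {vspace 'rV[R]_3}) : R :=
  let o := vpick ((a + b + c + d)^C)%VS in
  let br P Q := \det (\matrix_(i < 3) [:: vpick P; vpick Q; o]`_i) in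
  (br a b * br c d) / (br b c * br d a).

Definition chi (a b c d : {vspace 'rV[R]_3}) : R := cross_ratio b a c d.

(* x_j(A).  With m = 2k for an index k of A, the indices k - 2, ..., k + 2
   become m - 4, ..., m + 4; j has the parity of A iff j = 2k for some index k
   of A, and otherwise j = 2k + 1. *)
Definition x_coord e A (j : int) : R :=
  if has_parity e j then
    let m := j in
    let B := meet (line (A (m - 4)) (A (m - 2))) (line (A m) (A (m + 2))) in
    let D := meet (line (A (m - 4)) (A (m - 2))) (line (A (m + 2)) (A (m + 4))) in
    chi (A (m - 4)) (A (m - 2)) B D
  else
    let m := j - 1 in
    let C := meet (line (A (m - 2)) (A m)) (line (A (m + 2)) (A (m + 4))) in
    let D := meet (line (A (m - 4)) (A (m - 2))) (line (A (m + 2)) (A (m + 4))) in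
    chi (A (m + 4)) (A (m + 2)) C D.

Definition x_vec (n : nat) e A : 'I_(2 * n) -> R :=
  fun j => x_coord e A (j.+1)%:Z.
Arguments x_vec n e A j : clear implicits.

(* Only used for polygons indexed by Z. *)
Definition y_coord A (j : int) : R :=
  if has_parity false j
  then - (x_coord false A j * x_coord false A (j + 1))^-1
  else - (x_coord false A j * x_coord false A (j + 1)).

Definition pentagram A : ptseq R :=
  fun m => meet (line (A (m - 3)) (A (m + 1))) (line (A (m - 1)) (A (m + 3))).

(* P_n (e = false) and P_n^* (e = true) are handled through representatives:
   a point is a twisted n-gon, and two n-gons are the same point when they are
   projectively equivalent.  Since four consecutive vertices are in general
   position, (x_1, ..., x_2n) identifies either space with (R \ {0})^(2n),
   and it is through these coordinates that it is an algebraic variety.  All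
   the sets below are saturated for projective equivalence, because the x_j
   are invariant. *)
Definition zariski_open (n : nat) e (U : set (ptseq R)) : Prop :=
  exists H : set {mpoly R[2 * n]},
    U = [set A | twisted_ngon n e A /\
                 exists2 h, H h & h.@[x_vec n e A] != 0]%classic.

Definition zariski_dense_in (n : nat) e (X U : set (ptseq R)) : Prop :=
  forall W, zariski_open n e W ->
    (W `&` X !=set0)%classic -> (W `&` (U `&` X) !=set0)%classic.

(* P holds for generic A in X, where X is a subset of P_n. *)
Definition generic (n : nat) (X : set (ptseq R)) (P : ptseq R -> Prop) : Prop :=
  exists U, [/\ zariski_open n false U, zariski_dense_in n false X U
              & forall A, (U `&` X)%classic A -> P A].

(* F induces a regular map from the open subset U of P_n or P_n^* (parity e) to
   P_n or P_n^* (parity e'). *)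
Definition regular_map (n : nat) e e' (U : set (ptseq R))
    (F : ptseq R -> ptseq R) : Prop :=
  (forall A, U A -> twisted_ngon n e' (F A)) /\
  exists f g : 'I_(2 * n) -> {mpoly R[2 * n]},
    forall A, U A -> forall j,
      (g j).@[x_vec n e A] != 0 /\
      x_vec n e' (F A) j = (f j).@[x_vec n e A] / (g j).@[x_vec n e A].

(* All the polygons A, T(A), ..., T^k(A) of the construction are twisted
   n-gons. *)
Definition iterates_defined (n k : nat) A : Prop :=
  forall i, (i <= k)%N -> twisted_ngon n (odd i) (iter i pentagram A).

(* T^k, as a rational map on P_n, is regular at A: some regular map on a
   neighbourhood U of A is given on a dense open set by iterating the
   construction k times.  The latter may well fail at A itself. *)
Definition nonsingular (n k : nat) A : Prop :=
  exists (U : set (ptseq R)) (F : ptseq R -> ptseq R),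
    [/\ zariski_open n false U, U A, regular_map n false (odd k) U F
      & exists V, [/\ zariski_open n false V,
          zariski_dense_in n false (twisted_ngon n false) V
        & forall B, (U `&` V)%classic B ->
            iterates_defined n k B /\
            proj_equiv (odd k) (F B) (iter k pentagram B)]].

(* X_S; for S empty this is P_n. *)
Definition X_set (n : nat) (S : set int) : set (ptseq R) :=
  [set A | twisted_ngon n false A /\ forall i, S i -> y_coord A (2 * i) = -1]%classic.

End Polygons.

(* Main.v *)
From HB Require Import structures.
Require Import Defs.
From mathcomp Require Import all_boot all_order all_algebra.
From mathcomp Require Import boolp classical_sets reals.
From mathcomp Require Import mpoly.
From mathcomp Require Import zify ring.
Import Order.TTheory GRing.Theory Num.Theory.

(** Why the theorem is true. A twisted polygon lifts to vectors of R^3 with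
    V_(j+3) = V_(j+2) + b_j V_(j+1) + c_j V_j, where b and c are n-periodic and
    nowhere zero; they are unique and can replace the corner invariants as
    coordinates on P_n ([twisted_coords], [x_coordE], [xvK]). With
    d_j = b_j + c_(j+1), the pentagram map becomes b'_j = b_j d_(j+2) / d_j,
    c'_j = c_(j+1) d_(j+2) / d_j ([coords_pentagram]), and y_(2i) = -1 means
    d_(i-2) = 0 ([y_coordE]). So X_S is, in these coordinates, an open part of a
    linear space, and for nonempty S the first step of the iteration divides by
    zero everywhere on it.

    The remedy is to obtain the iterates without iterating. Let rho_w(j) be the
    product over i = 1, ..., w of the values c_j of the i-th iterate. The
    iterate of order n + 1 is a Laurent monomial in b, c, rho_n and rho_(n+1)
    ([iter_pent_b], [iter_pent_c]). On the other hand rho_w(j) is the ratio of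
    two corners of a solution of a homogeneous linear system, the strip system,
    whose coefficients are 1 or values of b and c up to sign: its equations express the
    factorisation of products of the operators S^2 + c and S^3 - b S, S being
    the shift ([strip_exists]). Cramer's rule then writes rho_w(j) as a quotient of
    two polynomials ([strip_ratio]), and everything reduces to finding one
    point of X_S at which these polynomials do not vanish, because X_S is
    irreducible ([pencil_dense], [principal_open_dense]).

    Such a point is given by d_j = 0 for all j outside one residue class modulo
    n, which exists in X_S since S misses an index. The nonzero values of d
    occupy a periodic set of positions of the strip, and as n is odd this set
    meets every n by n block in a permutation matrix. A solution of the strip
    system of width n or n + 1 with a vanishing corner is then forced to be
    zero ([strip_zero], [strip_zero_succ], [strip_corner]), which is the
    nonvanishing of the minors ([rho_rational]). *)

Local Open Scope ring_scope.
Set Implicit Arguments.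
Unset Strict Implicit.
Unset Printing Implicit Defensive.

(** * Strip systems and their solutions at a special point *)

(** Coefficients indexed by [nat] are extended by 0 to the index -1. *)
Definition prev {R : pzRingType} (f : nat -> R) (l : nat) : R :=
  if l is l'.+1 then f l' else 0.

Section Rows.
Context {F : fieldType}.
Implicit Types (e g rhs : nat -> F) (h : nat -> nat -> F) (b c : int -> F).

(** A row of a strip reads e(l-1) + g(l) e(l) = rhs(l). With invertible g it
    determines e upwards from e(-1) = 0, and downwards from the indices where e
    is known to vanish; both propagations stop at the support of rhs. *)
Lemma chain_zero_below e g rhs m :
  (forall l, g l != 0) -> (forall l, prev e l + g l * e l = rhs l) ->
  (forall l, (l < m)%N -> rhs l = 0) -> forall l, (l < m)%N -> e l = 0.
Proof.
move=> g0 E rhs0; elim=> [|l IH] lm; apply: (mulfI (g0 _)); rewrite mulr0.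
  by rewrite -(rhs0 _ lm) -E /= add0r.
by rewrite -(rhs0 _ lm) -E /= IH ?add0r // ltnW.
Qed.

Lemma chain_zero_above e g rhs m N :
  (forall l, prev e l + g l * e l = rhs l) ->
  (forall l, (N <= l)%N -> e l = 0) ->
  (forall l, (m < l)%N -> rhs l = 0) -> forall l, (m <= l)%N -> e l = 0.
Proof.
move=> E eN rhs0 l ml; have [k] := ubnP (N - l)%N.
elim: k l ml => // k IH l ml lk.
have [/eN//|lN] := leqP N l.
have := E l.+1; rewrite rhs0 // IH ?mulr0 ?addr0 //; first by lia.
by lia.
Qed.

(** When rhs lives at a single index m, the two propagations meet there and leave
    no room for e, so that rhs vanishes at m too. *)
Lemma chain_zero_single e g rhs m N :
  (forall l, g l != 0) -> (forall l, prev e l + g l * e l = rhs l) ->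
  (forall l, (N <= l)%N -> e l = 0) ->
  (forall l, l != m -> rhs l = 0) -> forall l, e l = 0.
Proof.
move=> g0 E eN rhs0 l; have [ml|lm] := leqP m l.
  by apply: (chain_zero_above E eN _ ml) => k mk; apply: rhs0; lia.
by apply: (chain_zero_below g0 E _ lm) => k mk; apply: rhs0; lia.
Qed.

(** When rhs lives at 0 and m, a nonzero e has no zero in [0, m): consecutive
    values there are proportional. One zero therefore kills the row. *)
Lemma chain_zero_pair e g rhs m N k :
  (forall l, g l != 0) -> (forall l, prev e l + g l * e l = rhs l) ->
  (forall l, (N <= l)%N -> e l = 0) ->
  (forall l, l != 0%N -> l != m -> rhs l = 0) ->
  (k < m)%N -> e k = 0 -> forall l, e l = 0.
Proof.
move=> g0 E eN rhs0 km ek.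
have e0 : e 0%N = 0.
  elim: k km ek => // k IH km ek; apply: IH; first by lia.
  by have := E k.+1; rewrite /= ek mulr0 addr0 rhs0 //; lia.
have elow l : (l < m)%N -> e l = 0.
  elim: l => // l IH lm; apply: (mulfI (g0 l.+1)).
  have := E l.+1; rewrite /= IH ?add0r ?mulr0; last lia.
  by move=> ->; rewrite rhs0 //; lia.
move=> l; have [ml|/elow//] := leqP m l.
by apply: (chain_zero_above E eN _ ml) => j mj; apply: rhs0; lia.
Qed.

(** Let S be the shift of sequences, P = S^2 + c and Q = S^3 - b S. The strip
    equations express M_i P = M_(i+1) Q for operators M_0, ..., M_w: at the base
    index j, M_i is the sum of the h_i(l) S^(w-i+2l), and the coefficients are
    compared at the index q + 2l - i, where q = j + w. The products of iterates
    of the pentagram map satisfy such equations (see [strip_exists]). *)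
Definition strip b c (q : int) (w : nat) h : Prop :=
  forall i l : nat, (i < w)%N ->
    prev (h i) l + c (q + (2 * l)%:Z - i%:Z) * h i l =
    prev (h i.+1) l - b (q + (2 * l)%:Z - i%:Z - 1) * h i.+1 l.

(** With d = [dsum b c], Q = S P - d S. This is the quantity whose vanishing makes
    the pentagram map singular. *)
Definition dsum b c (j : int) : F := b j + c (j + 1).

Definition periodic (n : nat) (f : int -> F) := forall j, f (j + n%:Z) = f j.

(** Where d vanishes, consecutive rows of a strip differ by a solution of a
    homogeneous chain, so that only the entries with d nonzero matter. *)
Lemma strip_diff {b c q w h} : strip b c q w h -> forall i l, (i < w)%N ->
  prev (fun k => h i k - h i.+1 k) l
     + c (q + (2 * l)%:Z - i%:Z) * (h i l - h i.+1 l)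
  = - (dsum b c (q + (2 * l)%:Z - i%:Z - 1) * h i.+1 l).
Proof.
move=> H i l iw; rewrite /dsum subrK.
have := H i l iw; case: l => [|l] /= E.
  by rewrite !add0r in E *; rewrite mulrBr E; ring.
set C := c _ in E *.
transitivity (h i l + C * h i l.+1 - h i.+1 l - C * h i.+1 l.+1); first by ring.
by rewrite E; ring.
Qed.

Section Special.
Variables (n : nat) (b c : int -> F) (j0 : int).
Hypotheses (nodd : odd n) (perc : periodic n c) (perb : periodic n b)
  (c0 : forall j, c j != 0)
  (dP : forall j, (dsum b c j != 0) = (n%:Z %| j - j0)%Z).

(** The positions (i, l) of the strip equations at which d does not vanish. *)
Definition special q (i l : nat) := (n%:Z %| q + (2 * l)%:Z - i%:Z - 1 - j0)%Z.

(** Since 2 is invertible modulo n, the special positions of an n by n block form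
    a permutation matrix. *)
Lemma special_row q i : exists2 l, (l < n)%N & special q i l.
Proof.
have n0 : (0 < n)%N by case: n nodd.
(* (n + 1) / 2 is the inverse of 2 modulo n *)
set x := (i%:Z + 1 + j0 - q) * (n.+1./2)%:Z.
exists `|(x %% n%:Z)%Z|%N; first by have := ltz_pmod x (d := n%:Z);
  have := modz_ge0 x (d := n%:Z); lia.
rewrite /special PoszM gez0_abs; last by apply: modz_ge0; lia.
have -> : q + 2%N%:Z * (x %% n)%Z - i%:Z - 1 - j0
  = (i%:Z + 1 + j0 - q - 2 * (x %/ n)%Z) * n.
  have E := divz_eq x n.
  have -> : (x %% n)%Z = x - (x %/ n)%Z * n by lia.
  rewrite /x; set k := (_ %/ _)%Z.
  have E2: (2 * (n.+1./2)%:Z = n%:Z + 1) by lia.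
  have : 2 * (i%:Z + 1 + j0 - q) * (n.+1./2)%:Z =
    (i%:Z + 1 + j0 - q) * (n%:Z + 1) by rewrite -E2; ring.
  by lia.
by rewrite dvdz_mull.
Qed.

Lemma special_col q l : exists2 i, (i < n)%N & special q i l.
Proof.
have n0 : (0 < n)%N by case: n nodd.
set x := q + (2 * l)%:Z - 1 - j0.
exists `|(x %% n%:Z)%Z|%N; first by have := ltz_pmod x (d := n%:Z);
  have := modz_ge0 x (d := n%:Z); lia.
rewrite /special gez0_abs; last by apply: modz_ge0; lia.
have -> : q + (2 * l)%:Z - (x %% n)%Z - 1 - j0 = (x %/ n)%Z * n.
  by have := divz_eq x n; rewrite /x; lia.
by rewrite dvdz_mull.
Qed.

Lemma special_uniq q i l l' : special q i l -> special q i l' -> (n%:Z %| l%:Z - l'%:Z)%Z.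
Proof.
rewrite /special => H H'.
have : (n%:Z %| 2 * (l%:Z - l'%:Z))%Z.
  have := rpredB H H'; congr (_ %| _)%Z; lia.
rewrite Gauss_dvdzr // coprimezE /= coprimen2 //.
Qed.

Let n0 : (0 < n)%N. Proof. by case: n nodd. Qed.

Lemma dsum0 q (i l : nat) : ~~ special q i l ->
  dsum b c (q + (2 * l)%:Z - i%:Z - 1) = 0.
Proof. by rewrite /special -dP negbK => /eqP. Qed.

(** If all rows agree, the chain equations reduce to d h = 0, and every column
    contains a special position. *)
Lemma strip_zero_of_equal_rows q w h : strip b c q w h -> (n <= w)%N ->
  (forall i l, (i < w)%N -> h i l = h i.+1 l) ->
  forall i l, (i <= w)%N -> h i l = 0.
Proof.
move=> H nw heq i l iw.
have h0 j : (j <= w)%N -> h j l = h 0%N l.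
  by elim: j => // j IH jw; rewrite -heq // IH // ltnW.
have [k kn sp] := special_col q l.
have kw := leq_trans kn nw.
rewrite h0 // -(h0 k.+1) //; apply/eqP.
have := strip_diff H (i := k) l kw.
have -> : prev (fun m => h k m - h k.+1 m) l = 0.
  by case: l {h0 sp} => //= l; rewrite heq // subrr.
rewrite heq // subrr mulr0 addr0 => /esym/eqP; rewrite oppr_eq0 mulf_eq0.
by rewrite -[_ == 0]negbK dP -/(special q k l) sp.
Qed.

Lemma strip_normal_row q w h i l0 : strip b c q w h -> (i < w)%N ->
  (forall r l, (w <= l)%N -> h r l = 0) ->
  (forall l, (l < w)%N -> l != l0 -> ~~ special q i l) ->
  forall l, h i l = h i.+1 l.
Proof.
move=> H iw hw sp l; apply/eqP; rewrite -subr_eq0; apply/eqP; move: l.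
apply: (chain_zero_single (g := fun l => c (q + (2 * l)%:Z - i%:Z)) (m := l0) (N := w)).
- by [].
- by move=> l; exact: (strip_diff H l iw).
- by move=> l wl; rewrite !hw // subrr.
- move=> l ll0; have [wl|lw] := leqP w l; first by rewrite hw // mulr0 oppr0.
  by rewrite dsum0 ?mul0r ?oppr0 // sp.
Qed.

(** For width n, every row has exactly one special position. *)
Lemma strip_zero q h : strip b c q n h ->
  (forall r l, (n <= l)%N -> h r l = 0) ->
  forall i l, (i <= n)%N -> h i l = 0.
Proof.
move=> H hw; apply: (strip_zero_of_equal_rows H) => // i l ik.
have [l0 l0n sp0] := special_row q i.
apply: (strip_normal_row H ik hw (l0 := l0)) => k kn; apply: contra => spk.
by have := special_uniq spk sp0; rewrite dvdzE => /dvdn_leq; lia.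
Qed.

Lemma dvdz_small (x : int) : (n%:Z %| x)%Z -> `|x| < n%:Z -> x = 0.
Proof. by rewrite dvdzE => /dvdn_leq; lia. Qed.

(** For width n + 1 the columns 0 and n are congruent, so a row is special either
    at one inner position or at both ends. Rows of the second kind are the only
    obstacle to the equality of all rows. There is one such row, or there are two,
    the rows 0 and n. *)
Lemma strip_zero_succ q h : strip b c q n.+1 h ->
  (forall r l, (n.+1 <= l)%N -> h r l = 0) ->
  forall i l, (i <= n.+1)%N -> h i l = 0.
Proof.
move=> H hw; apply: (strip_zero_of_equal_rows H) => //.
have normal i : (i < n.+1)%N -> ~~ special q i 0 -> forall l, h i l = h i.+1 l.
  move=> iw sp; have [l0 l0n sp0] := special_row q i.
  apply: (strip_normal_row H iw hw (l0 := l0)) => k kn; apply: contra => spk.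
  have D := special_uniq spk sp0; have [?|kn'] := ltnP k n.
    by have := dvdz_small D; lia.
  have ? : k = n by lia.
  subst k; case/negP: sp; move: spk; rewrite /special.
  rewrite (_ : q + (2 * n)%:Z - _ - 1 - j0 =
    q + (2 * 0)%N%:Z - i%:Z - 1 - j0 + 2 * n%:Z); last by lia.
  by rewrite rpredDr // dvdz_mull.
have pairrow i k : (i < n.+1)%N -> special q i 0 -> (k < n)%N -> h i k = h i.+1 k ->
    forall l, h i l = h i.+1 l.
  move=> iw sp kn hk l; apply/eqP; rewrite -subr_eq0; apply/eqP; move: l.
  apply: (chain_zero_pair (g := fun l => c (q + (2 * l)%:Z - i%:Z))
    (m := n) (N := n.+1) (k := k) _ (fun l => strip_diff H l iw)) => //.
  - by move=> l wl; rewrite !hw // subrr.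
  - move=> l l0 ln; have [wl|lw] := leqP n.+1 l; first by rewrite hw // mulr0 oppr0.
    rewrite dsum0 ?mul0r ?oppr0 //; apply/negP => spl.
    by have := dvdz_small (special_uniq spl sp); lia.
  - by rewrite hk subrr.
have run lo hi l : (lo <= hi)%N -> (hi <= n.+1)%N ->
    (forall i, (lo <= i < hi)%N -> ~~ special q i 0) -> h lo l = h hi l.
  elim: hi => [|hi IH] lh hin sp; first by have -> : lo = 0%N by lia.
  have [->//|lne] := eqVneq lo hi.+1.
  rewrite -normal ?IH //; try lia; last by apply: sp; lia.
  by move=> i ?; apply: sp; lia.
have sp_eq i i' : special q i 0 -> special q i' 0 -> (n%:Z %| i%:Z - i'%:Z)%Z.
  by rewrite /special => s s'; have := rpredB s' s; congr (_ %| _)%Z; lia.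
have sp_per : special q n 0 = special q 0 0.
  rewrite /special.
  rewrite [in RHS](_ : q + _ - _ - 1 - j0 = q + (2 * 0)%N%:Z - n%:Z - 1 - j0 + n%:Z);
    last by lia.
  by rewrite [RHS]rpredDr //; exact: dvdzz.
(* If the only row special at both ends is an inner row i, the rows 0 and n are
   special at a common column l1. Hence h_1 = h_i and h_(n+1) = h_(i+1) vanish
   at l1, which is a zero of the chain h_i - h_(i+1). *)
have [sp0|sp0] := boolP (special q 0 0); last first.
  move=> i l iw; have [spi|/normal->//] := boolP (special q i 0).
  have i0 : i != 0%N by apply: contraNneq sp0 => i0; rewrite i0 in spi.
  have in_ : i != n by apply: contraNneq sp0 => i_; rewrite i_ sp_per in spi.
  have [l1 l1n sp1] := special_row q 0.
  have l10 : l1 != 0%N by apply: contraNneq sp0 => l0; rewrite l0 in sp1.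
  have E1 r : (r < n.+1)%N -> (n %| r)%N -> h r.+1 l1 = 0.
    move=> rw nr; have := strip_diff H l1 rw.
    have spr l' : special q r l' = special q 0 l'.
      rewrite /special [in RHS](_ : q + _ - _ - 1 - j0 =
        q + (2 * l')%N%:Z - r%:Z - 1 - j0 + r%:Z); last by lia.
      by rewrite [RHS]rpredDr // dvdzE.
    have N : ~~ special q r 0 by rewrite spr.
    have -> : prev (fun m => h r m - h r.+1 m) l1 = 0.
      by case: (l1) => //= l'; rewrite normal // subrr.
    rewrite normal // subrr mulr0 addr0 => /esym/eqP; rewrite oppr_eq0 mulf_eq0.
    by rewrite -[_ == 0]negbK dP -/(special _ _ _) spr sp1 => /eqP.
  have others r : (r < n.+1)%N -> r != i -> ~~ special q r 0.
    move=> rw ri; apply/negP => spr; have D := sp_eq _ _ spr spi.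
    by have := dvdz_small D; lia.
  have low : h i l1 = 0.
    by rewrite -(run 1%N i) ?E1 //; [lia|lia|move=> ? ?; apply: others; lia].
  have high : h i.+1 l1 = 0.
    by rewrite (run i.+1 n.+1) ?E1 //; move=> ? ?; apply: others; lia.
  by apply: (pairrow i l1); rewrite // low high.
(* Otherwise the rows 0 and n are special at both ends. Their equations have the
   same coefficients by periodicity, and the inner rows give h_1 = h_n; so the
   difference e of the two chains solves a chain equation whose right-hand side
   involves h_n - h_(n+1), which vanishes at n. *)
have spn : special q n 0 by rewrite sp_per.
have mid r : (0 < r < n)%N -> ~~ special q r 0.
  move=> rn; apply/negP => spr; have D := sp_eq _ _ spr sp0.
  by have := dvdz_small D; lia.
have h1n l : h 1%N l = h n l by apply: run => // i ?; apply: mid; lia.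
pose e l := (h 0%N l - h 1%N l) - (h n l - h n.+1 l).
have E l : prev e l + c (q + (2 * l)%:Z - 0%N%:Z) * e l =
    - (dsum b c (q + (2 * l)%:Z - 0%N%:Z - 1) * (h n l - h n.+1 l)).
  have := strip_diff H l (ltn0Sn n); have := strip_diff H l (ltnSn n).
  have -> : c (q + (2 * l)%:Z - n%:Z) = c (q + (2 * l)%:Z - 0%N%:Z).
    by rewrite -(perc (_ - _)); congr c; lia.
  have -> : dsum b c (q + (2 * l)%:Z - n%:Z - 1) = dsum b c (q + (2 * l)%:Z - 0%N%:Z - 1).
    by rewrite /dsum -(perb (_ - 1)) -(perc (_ + 1)); congr (b _ + c _); lia.
  rewrite -h1n /e; set C := c _; set D := dsum _ _ _.
  case: l C D => [|l] C D; rewrite /= -?h1n => A B.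
    rewrite !add0r in A B *; rewrite mulrBr A B; ring.
  transitivity ((h 0%N l - h 1%N l + C * (h 0%N l.+1 - h 1%N l.+1))
    - (h 1%N l - h n.+1 l + C * (h 1%N l.+1 - h n.+1 l.+1))); first by ring.
  by rewrite A B; ring.
have topn l : (n <= l)%N -> h n l - h n.+1 l = 0.
  apply: (chain_zero_above (m := n) (N := n.+1) (fun l => strip_diff H l (ltnSn n))) =>
    [k|k] nk; first by rewrite !hw // subrr.
  by rewrite hw ?mulr0 ?oppr0.
have spl l : (l <= n)%N -> special q 0 l -> l = 0%N \/ l = n.
  by move=> ln spl; have := dvdz_small (special_uniq spl sp0); lia.
have e0 l : e l = 0.
  apply: (chain_zero_single (g := fun l => c (q + (2 * l)%:Z - 0%N%:Z))
    (m := 0%N) (N := n.+1) _ E) => // {}l.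
    by move=> nl; rewrite /e !hw // !subrr.
  move=> l0; have [nl|ln] := leqP n l; first by rewrite topn // mulr0 oppr0.
  rewrite dsum0 ?mul0r ?oppr0 //; apply/negP => s.
  by have := spl l; move/(_ (ltnW ln) s); lia.
have hn0 : h n 0%N = h n.+1 0%N.
  have := E 0%N; rewrite /= e0 mulr0 addr0 => /esym/eqP.
  by rewrite oppr_eq0 mulf_eq0 -[dsum _ _ _ == 0]negbK dP -/(special _ _ _) sp0 /= subr_eq0 => /eqP.
have hn l : h n l = h n.+1 l by apply: (pairrow n 0%N).
move=> i l iw; have [i0|i0] := eqVneq i 0%N; last first.
  have [->//|in_] := eqVneq i n.
  by apply: normal => //; apply: mid; lia.
have := e0 l; rewrite /e hn subrr subr0 i0 => /eqP.
by rewrite subr_eq0 => /eqP.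
Qed.

End Special.

(** A vanishing corner of the last row makes a whole outer column vanish: the last
    column is constant, and consecutive entries of the first column have the
    ratio -c/b. Deleting that column leaves a solution supported on w columns. *)
Lemma strip_corner b c q w h :
  (forall j, b j != 0) -> (forall j, c j != 0) ->
  (forall q' h', strip b c q' w h' -> (forall r l, (w <= l)%N -> h' r l = 0) ->
     forall i l, (i <= w)%N -> h' i l = 0) ->
  strip b c q w h -> (forall r l, (w < l)%N -> h r l = 0) ->
  h w w = 0 \/ h w 0%N = 0 -> forall i l, (i <= w)%N -> h i l = 0.
Proof.
move=> b0 c0 Z H hw [corner|corner].
- have col i : (i <= w)%N -> h i w = 0.
    move=> iw; rewrite -(subKn iw); elim: (w - i)%N => [|k IH]; first by rewrite subn0.
    have [wk|kw] := leqP w k.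
      have -> : (w - k.+1 = w - k)%N by lia.
      exact: IH.
    have := H (w - k.+1)%N w.+1 ltac:(lia);
      rewrite /= !(hw _ w.+1) ?mulr0 ?addr0 ?subr0 // => ->.
    by rewrite -[RHS]IH; congr (h _ _); lia.
  pose h' r l := if (r <= w)%N then h r l else 0.
  have Z' : forall i l, (i <= w)%N -> h' i l = 0.
    apply: (Z q) => [i l iw|r l wl]; last first.
      rewrite /h'; case: ifP => // rw; have [->|?] := eqVneq l w; first exact: col.
      by rewrite hw //; lia.
    by have := H i l iw; case: l => [|l] /=; rewrite /h' iw (ltnW iw).
  by move=> i l iw; have := Z' i l iw; rewrite /h' iw.
- have col i : (i <= w)%N -> h i 0%N = 0.
    move=> iw; rewrite -(subKn iw); elim: (w - i)%N => [|k IH]; first by rewrite subn0.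
    have [wk|kw] := leqP w k.
      have -> : (w - k.+1 = w - k)%N by lia.
      exact: IH.
    apply: (mulfI (c0 (q + (2 * 0)%:Z - (w - k.+1)%N%:Z))); rewrite mulr0.
    have := H (w - k.+1)%N 0%N ltac:(lia); rewrite /= !add0r => ->.
    by rewrite (_ : (w - k.+1).+1 = w - k)%N ?IH ?mulr0 ?oppr0 //; lia.
  pose h' r l := if (r <= w)%N then h r l.+1 else 0.
  have Z' : forall i l, (i <= w)%N -> h' i l = 0.
    apply: (Z (q + 2)) => [i l iw|r l wl]; last by rewrite /h'; case: ifP => // _;
      apply: hw.
    have := H i l.+1 iw; rewrite /h' iw (ltnW iw).
    rewrite (_ : q + (2 * l.+1)%:Z = q + 2 + (2 * l)%:Z); last by lia.
    by case: l => [|l] //=; rewrite !col // ltnW.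
  by move=> i [|l] iw; [apply: col | have := Z' i l iw; rewrite /h' iw].
Qed.

(** * The pentagram map on the coefficients of a recurrence *)

(** The effect of the pentagram map on the coefficients of the recurrence
    V_(j+3) = V_(j+2) + b_j V_(j+1) + c_j V_j. *)
Definition pent_b b c (j : int) := b j * dsum b c (j + 2) / dsum b c j.
Definition pent_c b c (j : int) := c (j + 1) * dsum b c (j + 2) / dsum b c j.
Definition pent (z : (int -> F) * (int -> F)) := (pent_b z.1 z.2, pent_c z.1 z.2).

Lemma pent_dsum b c j : dsum b c j != 0 ->
  pent_b b c j + pent_c b c j = dsum b c (j + 2).
Proof.
by move=> d0; rewrite /pent_b /pent_c -mulrDl -mulrDl -/(dsum b c j) mulrC mulKf.
Qed.

Lemma pent_cross b c j : pent_b b c j * c (j + 1) = pent_c b c j * b j.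
Proof. by rewrite /pent_b /pent_c; ring. Qed.

(** The lowest coefficient of P_w ... P_1, where P_i is the operator S^2 + c of the
    i-th iterate. *)
Definition rho (z : (int -> F) * (int -> F)) (w : nat) (j : int) :=
  \prod_(i < w) (iter i.+1 pent z).2 j.

(** Let P_i, Q_i be the operators of the i-th iterate. The identities [pent_dsum]
    and [pent_cross] say that P_(i+1) Q_i = Q_(i+1) P_i. Hence the operators
    M_i = Q_w ... Q_(i+1) P_i ... P_1 satisfy M_i P_0 = M_(i+1) Q_0, and
    M_w = P_w ... P_1 has leading coefficient 1 and lowest coefficient rho. *)
Lemma strip_exists z w j :
  (forall i k, (i < w)%N -> dsum (iter i pent z).1 (iter i pent z).2 k != 0) ->
  exists h, [/\ strip z.1 z.2 (j + w%:Z) w h, forall r l, (w < l)%N -> h r l = 0,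
    h w w = 1 & h w 0%N = rho z w j].
Proof.
elim: w z => [|w IH] z d0.
  exists (fun _ l => (l == 0%N)%:R); split => //; first by move=> r [].
  by rewrite /rho big_ord0.
have [|h' [H hw h1 hrho]] := IH (pent z).
  by move=> i k iw; have := d0 i.+1 k iw; rewrite iterSr.
set b' := (pent z).1 in H; set c' := (pent z).2 in H.
pose h i l :=
  if i is i'.+1 then prev (h' i') l + c' (j + w%:Z + (2 * l)%:Z - i'%:Z) * h' i' l
  else prev (h' 0%N) l - b' (j + w%:Z + (2 * l)%:Z) * h' 0%N l.
exists h; split.
- move=> i l iw.
  have hi m : h i m = prev (h' i) m - b' (j + w%:Z + (2 * m)%:Z - i%:Z) * h' i m.
    case: i iw => [|i] iw; first by rewrite /= subr0.
    rewrite /= (H i m) //; congr (_ - b' _ * _); lia.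
  have hi1 m : h i.+1 m = prev (h' i) m + c' (j + w%:Z + (2 * m)%:Z - i%:Z) * h' i m by [].
  set p := j + w%:Z + (2 * l)%:Z - i%:Z.
  have d := d0 0%N _ isT; rewrite /= in d.
  have X := pent_cross z.1 z.2 p.
  have -> : j + w.+1%:Z + (2 * l)%:Z - i%:Z = p + 1 by rewrite /p; lia.
  rewrite addrK.
  case: l @p X => [|l] p X.
    rewrite hi hi1 /= -/p !add0r.
    have -> : z.2 (p + 1) * - (b' p * h' i 0%N) =
      - (pent_b z.1 z.2 p * z.2 (p + 1)) * h' i 0%N by rewrite /b' /=; ring.
    rewrite X /c' /=; ring.
  have prevS (f : nat -> F) : prev f l.+1 = f l by [].
  rewrite !prevS !hi !hi1 -/p.
  have -> : j + w%:Z + (2 * l)%:Z - i%:Z = p - 2 by rewrite /p; lia.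
  have := pent_dsum (d (p - 2)).
  rewrite subrK /dsum -[pent_b _ _ _]/(b' _) -[pent_c _ _ _]/(c' _) => Y.
  move: X; rewrite -[pent_b _ _ _]/(b' _) -[pent_c _ _ _]/(c' _) => X.
  rewrite mulrBr mulrA (mulrC (z.2 _) (b' p)) X /=.
  have -> : c' (p - 2) = z.1 p + z.2 (p + 1) - b' (p - 2) by rewrite -Y; ring.
  ring.
- move=> r [|l] // wl; case: r => [|r] /=; rewrite !hw ?mulr0 ?addr0 ?subr0 //; lia.
- by rewrite /h /= h1 hw // mulr0 addr0.
- rewrite /h /= add0r hrho /rho [RHS]big_ord_recl; congr (_ * _).
    by rewrite (_ : j + w%:Z + (2 * 0)%:Z - w%:Z = j) //; lia.
  by apply: eq_bigr => i _; rewrite -iterSr.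
Qed.

Lemma iter_pent_c z j w : (forall i, (i <= w.+1)%N -> (iter i pent z).2 j != 0) ->
  (iter w.+1 pent z).2 j = rho z w.+1 j / rho z w j.
Proof.
move=> c0; rewrite /rho big_ord_recr /= mulrAC divff ?mul1r //.
by apply/prodf_neq0 => i _; apply: (c0 i.+1); have := ltn_ord i; lia.
Qed.

(** The identity b' c(j+1) = c' b telescopes along the iteration, so that the
    products of the c determine the b as well. *)
Lemma iter_pent_b z j w :
  (forall i k, (i <= w.+1)%N -> (iter i pent z).2 k != 0) ->
  (iter w.+1 pent z).1 j = z.1 j * rho z w.+1 j / (z.2 (j + 1) * rho z w (j + 1)).
Proof.
move=> c0.
have E k : (k <= w.+1)%N -> (iter k pent z).1 j * \prod_(i < k) (iter i pent z).2 (j + 1) =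
   z.1 j * rho z k j.
  elim: k => [|k IH] kw; first by rewrite /rho !big_ord0.
  rewrite big_ord_recr /rho big_ord_recr /= -/(rho z k j).
  rewrite mulrCA mulrC pent_cross -mulrA IH 1?ltnW //.
  by rewrite mulrCA [X in _ = _ * X]mulrC.
have := E w.+1 (leqnn _); rewrite big_ord_recl => <-.
rewrite -/(rho z w (j + 1)) mulfK // mulf_neq0 ?(c0 0%N) //.
by apply/prodf_neq0 => i _; apply: (c0 i.+1); have := ltn_ord i; lia.
Qed.

Lemma periodic_pent n z : periodic n z.1 -> periodic n z.2 ->
  periodic n (pent z).1 /\ periodic n (pent z).2.
Proof.
move=> pb pc.
have pd : periodic n (dsum z.1 z.2).
  by move=> j; rewrite /dsum pb (_ : j + n%:Z + 1 = j + 1 + n%:Z) ?pc // addrAC.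
split=> j; rewrite /= /pent_b /pent_c.
  by rewrite pb pd (addrAC j n%:Z 2) pd.
by rewrite pd (addrAC j n%:Z 2) pd (addrAC j n%:Z 1) pc.
Qed.

End Rows.

(** * Kernel vectors of matrices with polynomial entries *)

Section Poly.
Context {R : fieldType} {N : nat}.
Implicit Types (f g : ('I_N -> R) -> R).

Definition polyf f := exists p : {mpoly R[N]}, forall v, f v = p.@[v].

Lemma polyf_const a : polyf (fun=> a).
Proof. by exists a%:MP => v; rewrite mevalC. Qed.
Lemma polyf_coord i : polyf (fun v => v i).
Proof. by exists 'X_i => v; rewrite mevalXU. Qed.
Lemma polyfD f g : polyf f -> polyf g -> polyf (fun v => f v + g v).
Proof. by case=> p E [q G]; exists (p + q) => v; rewrite mevalD E G. Qed.
Lemma polyfM f g : polyf f -> polyf g -> polyf (fun v => f v * g v).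
Proof. by case=> p E [q G]; exists (p * q) => v; rewrite mevalM E G. Qed.
Lemma polyfN f : polyf f -> polyf (fun v => - f v).
Proof. by case=> p E; exists (- p) => v; rewrite mevalN E. Qed.

Lemma polyf_mx m k (A : ('I_N -> R) -> 'M[R]_(m, k)) :
  (forall i j, polyf (fun v => A v i j)) ->
  exists P : 'M[{mpoly R[N]}]_(m, k), forall v, A v = map_mx (meval v) P.
Proof.
move=> h; have /choice [p E] : forall ij, exists p : {mpoly R[N]}, forall v,
  A v ij.1 ij.2 = p.@[v].
  by move=> ij; apply: h.
exists (\matrix_(i, j) p (i, j)) => v; apply/matrixP => i j.
by rewrite !mxE -(E (i, j)).
Qed.

(** Cramer's rule with parameters. If at v0 a kernel vector of A(v0) is determined
    by its coordinate s, then some maximal minor of A(v) extended by the column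
    of that coordinate is invertible at v0, and it expresses the coordinate t
    of every kernel vector, at every v. As A has more rows than columns, a
    nonzero kernel vector exists at v0; its coordinates s and t are nonzero, which
    makes the numerator nonzero. *)
Lemma ker_ratio k m (A : ('I_N -> R) -> 'M[R]_(k, m)) (s t : 'I_k) v0 :
  (m < k)%N -> (forall i j, polyf (fun v => A v i j)) ->
  (forall u : 'rV_k, u *m A v0 = 0 -> u 0 s = 0 \/ u 0 t = 0 -> u = 0) ->
  exists p q : {mpoly R[N]}, [/\ p.@[v0] != 0, q.@[v0] != 0 &
    forall v (u : 'rV_k), u *m A v = 0 -> u 0 t * q.@[v] = u 0 s * p.@[v]].
Proof.
move=> mk /polyf_mx [P AP] inj.
pose B : 'M[{mpoly R[N]}]_(k, m + 1) := row_mx P (delta_mx s 0).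
have BE v : map_mx (meval v) B = row_mx (A v) (delta_mx s 0).
  by rewrite map_row_mx map_delta_mx AP.
have Bs (u : 'rV[R]_k) v : u *m A v = 0 ->
    u *m map_mx (meval v) B = u 0 s *: row_mx 0 (delta_mx 0 0).
  move=> uA; rewrite BE mul_mx_row uA scale_row_mx scaler0; congr row_mx.
  rewrite -colE; apply/matrixP => i j; rewrite !mxE.
  by rewrite !ord1 mulr1.
have rf : row_full (map_mx (meval v0) B)^T.
  rewrite /row_full mxrank_tr -/(row_free _) -kermx_eq0.
  apply/eqP/row_matrixP => i; rewrite row0.
  have K : row i (kermx (map_mx (meval v0) B)) *m map_mx (meval v0) B = 0.
    by rewrite -row_mul mulmx_ker row0.
  move: K; rewrite BE mul_mx_row => /eqP; rewrite row_mx_eq0 => /andP[/eqP uA /eqP us].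
  apply: inj => //; left.
  by move: us; rewrite -colE => /matrixP /(_ 0 0); rewrite !mxE.
(* columns of the extended matrix that form a basis at v0 *)
pose f := fullrankfun rf.
pose C := colsub f B.
have CE v : map_mx (meval v) C = colsub f (map_mx (meval v) B).
  by apply/matrixP => i j; rewrite !mxE.
pose w : 'rV[{mpoly R[N]}]_k := colsub f (row_mx 0 (delta_mx 0 0)).
have Cs (u : 'rV[R]_k) v : u *m A v = 0 ->
    u *m map_mx (meval v) C = u 0 s *: map_mx (meval v) w.
  move=> uA; rewrite CE.
  have -> : u *m colsub f (map_mx (meval v) B) = colsub f (u *m map_mx (meval v) B).
    by apply/matrixP => i j; rewrite !mxE; apply: eq_bigr => l _; rewrite !mxE.
  rewrite Bs //; apply/matrixP => i j; rewrite !mxE; congr (_ * _).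
  by case: split => ?; rewrite !mxE ?rmorph0 // rmorph_nat.
exists ((w *m \adj C) 0 t), (\det C).
have q0 : (\det C).@[v0] != 0.
  rewrite -det_map_mx CE -unitfE -unitmxE -unitmx_tr.
  rewrite (_ : _^T = rowsub f (map_mx (meval v0) B)^T); last first.
    by apply/matrixP => i j; rewrite !mxE.
  exact: fullrowsub_unit.
have main v (u : 'rV_k) : u *m A v = 0 -> u 0 t * (\det C).@[v] =
  u 0 s * ((w *m \adj C) 0 t).@[v].
  move=> uA; have := congr1 (fun M => M *m map_mx (meval v) (\adj C)) (Cs u v uA).
  rewrite -mulmxA -map_mxM mul_mx_adj -scalemxAl -map_mxM map_scalar_mx mul_mx_scalar.
  by move/matrixP => /(_ 0 t); rewrite !mxE mulrC.
split => //.
have [u uA u0] : exists2 u : 'rV[R]_k, u *m A v0 = 0 & u != 0.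
  have : kermx (A v0) != 0.
    rewrite kermx_eq0 -row_leq_rank -ltnNge.
    exact: leq_ltn_trans (rank_leq_col _) mk.
  case/rowV0Pn => u us u0; exists u => //; exact/sub_kermxP.
apply: contraNneq u0 => p0; apply/eqP; apply: inj => //; right.
by have := main _ _ uA; rewrite p0 mulr0 => /eqP; rewrite mulf_eq0 (negbTE q0) orbF => /eqP.
Qed.

End Poly.

Section StripMatrix.
Context {R : fieldType}.
Variables (b c : int -> R) (q : int) (w : nat).

Definition mx_ext (M : 'M[R]_w.+1) (i l : nat) : R :=
  if (i <= w)%N && (l <= w)%N then M (inord i) (inord l) else 0.

Definition strip_mx (M : 'M[R]_w.+1) : 'M[R]_(w, w.+2) :=
  \matrix_(i, l) (prev (mx_ext M i) l + c (q + (2 * l)%:Z - i%:Z) * mx_ext M i l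
    - (prev (mx_ext M i.+1) l - b (q + (2 * l)%:Z - i%:Z - 1) * mx_ext M i.+1 l)).

Arguments mx_ext : simpl never.

Lemma mx_extP a M M' i l : mx_ext (a *: M + M') i l = a * mx_ext M i l + mx_ext M' i l.
Proof. by rewrite /mx_ext; case: ifP; rewrite ?mxE // mulr0 addr0. Qed.

Lemma strip_mx_linear : linear strip_mx.
Proof.
move=> a M M'; apply/matrixP => i [l lw]; rewrite !mxE !mx_extP /=.
case: l {lw} => [|l] /=; rewrite ?mx_extP; ring.
Qed.

HB.instance Definition _ :=
  GRing.isLinear.Build R 'M[R]_w.+1 'M[R]_(w, w.+2) _ strip_mx strip_mx_linear.

Lemma strip_mx0 M : strip_mx M = 0 <-> strip b c q w (mx_ext M).
Proof.
split=> [/matrixP H i l iw|H].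
  have [lw|wl] := ltnP l w.+2.
    by have := H (Ordinal iw) (Ordinal lw); rewrite !mxE => /eqP; rewrite subr_eq0 => /eqP.
  have z r : mx_ext M r l = 0 by rewrite /mx_ext; case: ifP => // /andP[]; lia.
  have pz r : prev (mx_ext M r) l = 0.
    case: l wl {z} => //= l wl; rewrite /mx_ext; case: ifP => // /andP[]; lia.
  by rewrite !z !pz !mulr0 subr0 addr0.
by apply/matrixP => i l; rewrite !mxE H ?subrr // ltn_ord.
Qed.

End StripMatrix.

(** There are (w+1)^2 unknowns and only w(w+2) equations, so that [ker_ratio]
    applies to the two corners of the last row. *)
Lemma strip_ratio {R : fieldType} N w (b c : ('I_N -> R) -> int -> R) q v0 :
  (forall j, polyf (b^~ j)) -> (forall j, polyf (c^~ j)) ->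
  (forall h, strip (b v0) (c v0) q w h -> (forall r l, (w < l)%N -> h r l = 0) ->
    h w w = 0 \/ h w 0%N = 0 -> forall i l, (i <= w)%N -> h i l = 0) ->
  exists p r : {mpoly R[N]}, [/\ p.@[v0] != 0, r.@[v0] != 0 &
    forall v h, strip (b v) (c v) q w h -> (forall i l, (w < l)%N -> h i l = 0) ->
      h w 0%N * r.@[v] = h w w * p.@[v]].
Proof.
move=> pb pc inj.
pose A v := lin_mx (strip_mx (b v) (c v) q (w := w)).
pose s := @mxvec_index w.+1 w.+1 (inord w) (inord w).
pose t := @mxvec_index w.+1 w.+1 (inord w) (inord 0).
have extE (M : 'M[R]_w.+1) (l : nat) : (l <= w)%N -> mx_ext M w l = M (inord w) (inord l).
  by move=> lw; rewrite /mx_ext leqnn lw.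
have [||u uA us|p [r [p0 r0 pr]]] := ker_ratio (A := A) (s := s) (t := t) (v0 := v0).
- by rewrite mulnS mulSn; lia.
- move=> i j; case/mxvec_indexP: j => j l.
  rewrite /A; under eq_fun do rewrite /lin_mx mxE /= mxvecE mxE.
  set M := vec_mx _.
  apply: polyfD; first by apply: polyfD; [exact: polyf_const|apply: polyfM => //;
    exact: polyf_const].
  apply: polyfN; apply: polyfD; first exact: polyf_const.
  by apply: polyfN; apply: polyfM => //; exact: polyf_const.
- have E : strip_mx (b v0) (c v0) q (vec_mx u) = 0.
    move: uA; rewrite -[u]vec_mxK mul_rV_lin mxvecK => /(congr1 vec_mx).
    by rewrite mxvecK linear0.
  rewrite -[u]vec_mxK; suff -> : vec_mx u = 0 by rewrite linear0.
  apply/matrixP => i l; rewrite [RHS]mxE.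
  have lw : (l <= w)%N by have := ltn_ord l.
  have iw : (i <= w)%N by have := ltn_ord i.
  have -> : vec_mx u i l = mx_ext (vec_mx u) i l.
    by rewrite /mx_ext lw iw /= !inord_val.
  apply: (inj (mx_ext (vec_mx u))) => //.
  + exact/strip_mx0.
  + by move=> k k' kw; rewrite /mx_ext andbC leqNgt kw.
  + by rewrite !extE // !mxE.
exists p, r; split=> // v h H hw.
pose M : 'M_w.+1 := \matrix_(i, l) h i l.
have ME i l : (i <= w)%N -> mx_ext M i l = h i l.
  move=> iw; rewrite /mx_ext iw /=; case: ifP => [lw|/negbT].
    by rewrite mxE !inordK.
  by rewrite -ltnNge => /hw ->.
have := pr v (mxvec M); rewrite !mxvecE !mxE !inordK //; apply.
rewrite mul_rV_lin /= mxvecK (_ : strip_mx _ _ _ _ = 0) ?linear0 //.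
apply/strip_mx0 => i l iw; have := H i l iw.
by case: l => [|l] /=; rewrite !ME ?(ltnW iw).
Qed.

(** * Determinants of order 3 and two-sided recursion *)

Lemma int_two_sided_ind (P : int -> Prop) : P 0 ->
  (forall j, P j -> P (j + 1)) -> (forall j, P (j + 1) -> P j) -> forall j, P j.
Proof.
move=> P0 up down; case=> k.
  by elim: k => // k /up; rewrite -addn1 PoszD.
elim: k => [|k IH]; apply: down; first by [].
by rewrite (_ : Negz k.+1 + 1 = Negz k) //; lia.
Qed.

(** The inverse steps g carry the recursion to the negative indices. *)
Lemma int_two_sided_rec (T : Type) (f g : int -> T -> T) (x : T) :
  (forall j, cancel (g j) (f j)) ->
  exists s : int -> T, s 0 = x /\ forall j, s (j + 1) = f j (s j).
Proof.
move=> gK.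
pose up := fix up k := if k is k'.+1 then f k'%:Z (up k') else x.
pose down := fix down k := g (Negz k) (if k is k'.+1 then down k' else x).
exists (fun j => match j with Posz k => up k | Negz k => down k end); split=> // -[k|[|k]].
- by rewrite -PoszD addn1.
- by rewrite (_ : Negz 0 + 1 = 0) //= gK.
- by rewrite (_ : Negz k.+1 + 1 = Negz k) //= ?gK //; lia.
Qed.

Section Det3.
Context {R : fieldType}.
Implicit Types (u v w x : 'rV[R]_3).

Definition mx3 u v w : 'M[R]_3 := \matrix_(i < 3) [:: u; v; w]`_i.
Definition det3 u v w : R := \det (mx3 u v w).

Lemma det3E u v w : det3 u v w =
  u 0 0 * (v 0 1 * w 0 2 - v 0 2 * w 0 1) - u 0 1 * (v 0 0 * w 0 2 - v 0 2 * w 0 0)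
  + u 0 2 * (v 0 0 * w 0 1 - v 0 1 * w 0 0).
Proof.
rewrite /det3 (expand_det_row _ 0) !big_ord_recl big_ord0.
rewrite /cofactor !(expand_det_row _ 0) !big_ord_recl !big_ord0 /cofactor !det_mx11 !mxE /=.
have -> : lift ord0 ord0 = 1 :> 'I_3 by apply/val_inj.
have -> : lift ord0 (lift ord0 ord0) = 2 :> 'I_3 by apply/val_inj.
have -> : lift (0 : 'I_2) 0 = 1 :> 'I_2 by apply/val_inj.
do 20?[match goal with |- context [@lift 3 ?i ?j] => first
  [ rewrite (_ : @lift 3 i j = 0); [|by apply/val_inj]
  | rewrite (_ : @lift 3 i j = 1); [|by apply/val_inj]
  | rewrite (_ : @lift 3 i j = 2); [|by apply/val_inj]] end].
rewrite (_ : ord0 = 0) //.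
rewrite /bump /=; ring.
Qed.

Lemma mul_mx3 (r : 'rV[R]_3) u v w : r *m mx3 u v w = r 0 0 *: u + r 0 1 *: v + r 0 2 *: w.
Proof.
rewrite mulmx_sum_row !big_ord_recl big_ord0 addr0 !rowK /= addrA.
by congr (_ *: _ + _ *: _ + _ *: _); congr (r _ _); apply/val_inj.
Qed.

Lemma full3 u v w : (<[u]> + <[v]> + <[w]> == fullv)%VS = (det3 u v w != 0).
Proof.
apply/idP/idP => [/eqP full|d].
  have mem x : exists r : 'rV_3, x = r *m mx3 u v w.
    have : x \in (<[u]> + <[v]> + <[w]>)%VS by rewrite full memvf.
    case/memv_addP => _ /memv_addP [_ /vlineP [a ->] [_ /vlineP [b ->] ->]] [_ /vlineP [c ->] ->].
    exists (\row_i [:: a; b; c]`_i).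
    by rewrite mul_mx3 !mxE.
  rewrite -unitfE -[_ \is a _]/(mx3 u v w \in unitmx) -row_full_unit.
  apply/row_fullP; have [f fE] := boolp.choice (fun i : 'I_3 => mem (delta_mx 0 i)).
  exists (\matrix_i f i); apply/row_matrixP => i.
  by rewrite row_mul rowK -fE rowE mulmx1.
apply/eqP/vspaceP => x; rewrite memvf.
rewrite -[x](mulmxKV (_ : mx3 u v w \in unitmx)) ?unitmxE ?unitfE //.
by rewrite mul_mx3 !memv_add // ?rpredZ ?memv_line.
Qed.

Lemma det3_expand u v w x : det3 u v w != 0 ->
  x = (det3 x v w / det3 u v w) *: u + (det3 u x w / det3 u v w) *: v
    + (det3 u v x / det3 u v w) *: w.
Proof.
move=> d; pose r := x *m invmx (mx3 u v w).
have xE : x = r 0 0 *: u + r 0 1 *: v + r 0 2 *: w.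
  by rewrite -mul_mx3 /r mulmxKV // unitmxE unitfE.
suff [-> -> ->] : [/\ det3 x v w = r 0 0 * det3 u v w, det3 u x w = r 0 1 * det3 u v w
  & det3 u v x = r 0 2 * det3 u v w] by rewrite !mulfK // -xE.
by rewrite {1 2 3}xE !det3E !mxE; split; ring.
Qed.

Lemma det3_inj u v w (a b c a' b' c' : R) : det3 u v w != 0 ->
  a *: u + b *: v + c *: w = a' *: u + b' *: v + c' *: w -> [/\ a = a', b = b' & c = c'].
Proof.
move=> d E.
have H k y : k * det3 u v w = y -> k = y / det3 u v w by move=> <-; rewrite mulfK.
split.
- rewrite (H a (det3 (a *: u + b *: v + c *: w) v w)); last by rewrite !det3E !mxE; ring.
  by rewrite E -(H a') // !det3E !mxE; ring.
- rewrite (H b (det3 u (a *: u + b *: v + c *: w) w)); last by rewrite !det3E !mxE; ring.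
  by rewrite E -(H b') // !det3E !mxE; ring.
- rewrite (H c (det3 u v (a *: u + b *: v + c *: w))); last by rewrite !det3E !mxE; ring.
  by rewrite E -(H c') // !det3E !mxE; ring.
Qed.

End Det3.

(** * Points, lines and cross ratios *)

Section Proj.
Context {R : realType}.
Implicit Types (u v w x p q : 'rV[R]_3) (A B : int -> {vspace 'rV[R]_3}) (b c : int -> R).

Lemma det3_neq0 u v w : det3 u v w != 0 -> [/\ u != 0, v != 0 & w != 0].
Proof.
by move=> d; split; apply: contraNneq d => ->; rewrite det3E !mxE; apply/eqP; ring.
Qed.

Lemma is_point_line (P : {vspace 'rV[R]_3}) : is_point P ->
  P = <[vpick P]>%VS /\ vpick P != 0.
Proof.
move=> /eqP dP; have P0 : vpick P != 0 by rewrite vpick0 -dimv_eq0 dP.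
by split=> //; apply/esym/eqP; rewrite eqEdim -memvE memv_pick dim_vline P0 dP.
Qed.

Lemma vpick_line v : v != 0 -> exists2 t : R, t != 0 & vpick <[v]>%VS = t *: v.
Proof.
move=> v0; have /vlineP [t E] := memv_pick <[v]>%VS; exists t => //.
apply: contraNneq v0 => t0; move: E; rewrite t0 scale0r => /eqP.
by rewrite vpick0 -dimv_eq0 dim_vline; case: (v == 0).
Qed.

Lemma dim_plane p q r : det3 p q r != 0 -> \dim (<[p]> + <[q]>)%VS = 2%N.
Proof.
move=> d; have /eqP full : (<[p]> + <[q]> + <[r]> == fullv)%VS by rewrite full3.
have [p0 q0 r0] := det3_neq0 d.
have := dimv_add_leqif (<[p]> + <[q]>)%VS <[r]>%VS => -[+ _].
have := dimv_add_leqif <[p]>%VS <[q]>%VS => -[+ _].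
by rewrite full dimvf /dim /= !dim_vline p0 q0 r0 /=; lia.
Qed.

(** Two lines that span the plane meet in one point only, by the dimension
    formula; r certifies that the second line is a line. *)
Lemma meet_line p q p' q' r x : det3 p q p' != 0 -> det3 p' q' r != 0 -> x != 0 ->
  x \in (<[p]> + <[q]>)%VS -> x \in (<[p']> + <[q']>)%VS ->
  meet (line <[p]> <[q]>) (line <[p']> <[q']>) = <[x]>%VS.
Proof.
move=> d d' x0 xU xW; rewrite /meet /line; apply/esym/eqP.
rewrite eqEdim -memvE memv_cap xU xW /= dim_vline x0.
have := dimv_sum_cap (<[p]> + <[q]>)%VS (<[p']> + <[q']>)%VS.
rewrite (dim_plane d) (dim_plane d').
have -> : (<[p]> + <[q]> + (<[p']> + <[q']>))%VS = fullv.
  apply/eqP; rewrite eqEsubv subvf /= addvA.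
  have /eqP <- : (<[p]> + <[q]> + <[p']> == fullv)%VS by rewrite full3.
  exact: addvSl.
by rewrite dimvf /dim /= mul1n => E; rewrite -(leq_add2l 3) E.
Qed.

(** In a basis (p, q) of the plane of R^3 that contains the four points, the
    bracket with the auxiliary vector o is det(p, q, o) times a 2 by 2 minor, and
    the scalars of the representatives cancel out. *)
Lemma cross_ratioE p q r (a1 a2 b1 b2 c1 c2 d1 d2 : R) :
  det3 p q r != 0 ->
  a1 * b2 - a2 * b1 != 0 -> b1 * c2 - b2 * c1 != 0 -> d1 * a2 - d2 * a1 != 0 ->
  c1 * d2 - c2 * d1 != 0 ->
  cross_ratio <[a1 *: p + a2 *: q]> <[b1 *: p + b2 *: q]>
    <[c1 *: p + c2 *: q]> <[d1 *: p + d2 *: q]>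
  = ((a1 * b2 - a2 * b1) * (c1 * d2 - c2 * d1)) /
    ((b1 * c2 - b2 * c1) * (d1 * a2 - d2 * a1)).
Proof.
move=> d ab bc da cd.
pose lc (k1 k2 : R) := k1 *: p + k2 *: q.
rewrite -![_ *: p + _ *: q]/(lc _ _).
have lcdet k1 k2 m1 m2 x : det3 (lc k1 k2) (lc m1 m2) x = (k1 * m2 - k2 * m1) * det3 p q x.
  by rewrite !det3E !mxE; ring.
have lc0 k1 k2 m1 m2 : k1 * m2 - k2 * m1 != 0 -> lc k1 k2 != 0 /\ lc m1 m2 != 0.
  move=> km; have : det3 (lc k1 k2) (lc m1 m2) r != 0 by rewrite lcdet mulf_neq0.
  by case/det3_neq0.
have [a0 b0] := lc0 _ _ _ _ ab; have [c0 d0] := lc0 _ _ _ _ cd.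
have planeE : (<[lc a1 a2]> + <[lc b1 b2]> + <[lc c1 c2]> + <[lc d1 d2]> =
  <[p]> + <[q]>)%VS.
  apply/eqP; rewrite eqEdim; apply/andP; split.
    by rewrite !subv_add -!memvE /lc !memv_add // ?rpredZ ?memv_line.
  have D : \dim (<[lc a1 a2]> + <[lc b1 b2]>)%VS = 2%N.
    by apply: (@dim_plane _ _ r); rewrite lcdet mulf_neq0.
  rewrite (dim_plane d); apply: leq_trans (eq_leq (esym D)) _.
  by apply: dimvS; rewrite -!addvA addvA; apply: addvSl.
rewrite /cross_ratio planeE; set o := vpick (_ ^C)%VS.
have o0 : det3 p q o != 0.
  rewrite -full3 eqEdim subvf /= dimvf /dim /=.
  have o_n0 : o != 0.
    rewrite vpick0 -dimv_eq0.
    have := dimv_compl (<[p]> + <[q]>)%VS; rewrite (dim_plane d) dimvf /dim => E.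
    by apply/eqP => E'; have := etrans (esym E') E.
  rewrite dimv_disjoint_sum ?(dim_plane d) ?dim_vline ?o_n0 //.
  apply/eqP; rewrite -subv0 -(capv_compl (<[p]> + <[q]>)%VS).
  by apply: capvS => //; rewrite -memvE memv_pick.
have [ta ta0 ->] := vpick_line a0; have [tb tb0 ->] := vpick_line b0.
have [tc tc0 ->] := vpick_line c0; have [td td0 ->] := vpick_line d0.
have S (s t : R) u v :
    \det (\matrix_(i < 3) [:: s *: u; t *: v; o]`_i) = s * t * det3 u v o.
  by rewrite -[LHS]/(det3 _ _ _) !det3E !mxE; ring.
rewrite !S !lcdet.
by field; rewrite ta0 tb0 tc0 td0 o0 bc da.
Qed.

End Proj.

(** * Normalised lifts of twisted polygons *)

Section Lift.
Context {R : realType}.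
Implicit Types (A B : ptseq R) (b c : int -> R) (V W : int -> 'rV[R]_3)
  (z : (int -> R) * (int -> R)) (s : int) (n : nat).

(** Normalised lifts: the coefficient of V_(j+2) is 1. This fixes the lift of a
    polygon up to a common scalar. *)
Definition recurrent z V : Prop := det3 (V 0) (V 1) (V 2) != 0 /\
  forall j, V (j + 3) = V (j + 2) + z.1 j *: V (j + 1) + z.2 j *: V j.

Definition nondeg n z : Prop := [/\ periodic n z.1, periodic n z.2,
  forall j, z.1 j != 0 & forall j, z.2 j != 0].

(** The vertex A_k, at the doubled index 2k = 2j + s, is lifted to V_j. The offset
    s is 0 for the polygons of P_n, and the pentagram map increases it by 3. *)
Definition coords s n A z : Prop := nondeg n z /\
  exists2 V, recurrent z V & forall j, A (2 * j + s) = <[V j]>%VS.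

Lemma recurrent_det z V : (forall j, z.2 j != 0) -> recurrent z V ->
  forall j, det3 (V j) (V (j + 1)) (V (j + 2)) != 0.
Proof.
move=> c0 [d E].
have S j : det3 (V (j + 1)) (V (j + 1 + 1)) (V (j + 1 + 2))
     = z.2 j * det3 (V j) (V (j + 1)) (V (j + 2)).
  rewrite -!(addrA j) (_ : 1 + 2 = 3 :> int) // (_ : 1 + 1 = 2 :> int) // E.
  by rewrite !det3E !mxE; ring.
apply: int_two_sided_ind => [|j dj|j]; first by rewrite !add0r.
  by rewrite S mulf_neq0.
by rewrite S mulf_eq0 negb_or => /andP[].
Qed.

Lemma recurrent_shift z V (k : int) : (forall j, z.2 j != 0) -> recurrent z V ->
  recurrent (fun j => z.1 (j + k), fun j => z.2 (j + k)) (fun j => V (j + k)).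
Proof.
move=> c0 rV; split=> [|j].
  rewrite /= add0r (addrC 1) (addrC 2); exact: (recurrent_det c0 rV k).
by rewrite /= (addrAC j 3) (addrAC j 2) (addrAC j 1) rV.2.
Qed.

Lemma recurrent_exists z : (forall j, z.2 j != 0) -> exists V, recurrent z V.
Proof.
move=> c0.
pose f j (t : 'rV[R]_3 * 'rV[R]_3 * 'rV[R]_3) :=
  (t.1.2, t.2, t.2 + z.1 j *: t.1.2 + z.2 j *: t.1.1).
pose g j (t : 'rV[R]_3 * 'rV[R]_3 * 'rV[R]_3) :=
  ((z.2 j)^-1 *: (t.2 - t.1.2 - z.1 j *: t.1.1), t.1.1, t.1.2).
have gK j : cancel (g j) (f j).
  move=> [[u v] w]; rewrite /f /g /= scalerA divff // scale1r; congr (_, _, _).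
  by apply/rowP => i; rewrite !mxE; ring.
have [st [st0 stS]] := int_two_sided_rec (delta_mx 0 0, delta_mx 0 1, delta_mx 0 2) gK.
exists (fun j => (st j).1.1).
have E1 j : (st (j + 1)).1.1 = (st j).1.2 by rewrite stS.
have E2 j : (st (j + 2)).1.1 = (st j).2.
  by rewrite (_ : j + 2 = j + 1 + 1) ?E1 ?stS //; lia.
split=> [|j]; last first.
  by rewrite (_ : j + 3 = j + 1 + 2) ?E1 ?E2 ?stS //; lia.
rewrite -(add0r 1) -(add0r 2) E1 E2 st0 /=.
rewrite det3E !mxE /= (_ : _ + _ = 1) ?oner_neq0 //; ring.
Qed.

(** A solution of the recurrence is determined linearly by three consecutive
    terms. *)
Lemma recurrent_map z V W : (forall j, z.2 j != 0) -> recurrent z V -> recurrent z W ->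
  exists phi : 'End('rV[R]_3), lker phi = 0%VS /\ forall j, phi (V j) = W j.
Proof.
move=> c0 rV rW.
pose MV := mx3 (V 0) (V 1) (V 2); pose MW := mx3 (W 0) (W 1) (W 2).
have uV : MV \in unitmx by rewrite unitmxE unitfE; case: rV.
have uW : MW \in unitmx by rewrite unitmxE unitfE; case: rW.
pose phi : 'End('rV[R]_3) := linfun (mulmxr (invmx MV *m MW)).
have phiE u : phi u = u *m invmx MV *m MW by rewrite lfunE /= mulmxA.
have base (i : 'I_3) : phi (row i MV) = row i MW.
  by rewrite phiE -row_mul mulmxV // -row_mul mul1mx.
exists phi; split.
  apply/eqP/lker0P => u v; rewrite !phiE => /(congr1 (mulmx^~ (invmx MW *m MV))).
  by rewrite !mulmxA !mulmxK // !mulmxKV.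
have P j : [/\ phi (V j) = W j, phi (V (j + 1)) = W (j + 1) & phi (V (j + 2)) = W (j + 2)].
  move: j; apply: int_two_sided_ind => [|j [P0 P1 P2]|j].
  - have := base 0; have := base 1; have := base 2.
    by rewrite !rowK /= => -> -> ->.
  - split; rewrite // -?addrA //.
    rewrite (_ : 1 + 2 = 3 :> int) // rV.2 rW.2.
    by rewrite !linearD !linearZ /= P0 P1 P2.
  rewrite -!addrA (_ : 1 + 1 = 2 :> int) // (_ : 1 + 2 = 3 :> int) // => -[P1 P2 P3].
  split=> //; apply: (scalerI (c0 j)).
  have := P3; rewrite rV.2 rW.2 !linearD !linearZ /= P1 P2.
  by move/addrI.
by move=> j; have [] := P j.
Qed.

Lemma coords_proj_equiv e s n A B z : (forall m, has_parity e m ->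
  exists j, m = 2 * j + s) ->
  coords s n A z -> coords s n B z -> proj_equiv e A B.
Proof.
move=> eP [[_ _ _ c0] [V rV VE]] [_ [W rW WE]].
have [phi [k phiE]] := recurrent_map c0 rV rW.
exists phi; split => // m /eP [j ->].
by rewrite VE WE limg_line phiE.
Qed.

Lemma coords_exists s n z : nondeg n z -> exists A, coords s n A z.
Proof.
move=> nd; have [_ _ _ c0] := nd; have [V rV] := recurrent_exists c0.
exists (fun m => <[V ((m - s) %/ 2)%Z]>%VS); split => //; exists V => // j.
by rewrite addrK mulrC mulzK.
Qed.

Lemma coords_twisted e s n A z : (forall m, has_parity e m -> exists j, m = 2 * j + s) ->
  coords s n A z -> twisted_ngon n e A.
Proof.
move=> eP [[pb pc b0 c0] [V rV VE]].
have det := recurrent_det c0 rV.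
split.
- move=> m /eP [j ->]; rewrite VE /is_point dim_vline.
  by have [-> ] := det3_neq0 (det j).
- have rW : recurrent z (fun j => V (j + n%:Z)).
    have := recurrent_shift n c0 rV.
    by case=> d E; split=> // j; have := E j; rewrite /= pb pc.
  have [phi [k phiE]] := recurrent_map c0 rV rW.
  exists phi; split=> // m /eP [j ->].
  rewrite (_ : 2 * j + s + (2 * n)%:Z = 2 * (j + n%:Z) + s); last by lia.
  by rewrite !VE limg_line phiE.
move=> m /eP [j ->].
rewrite (_ : 2 * j + s + 2 = 2 * (j + 1) + s); last by lia.
rewrite (_ : 2 * j + s + 4 = 2 * (j + 2) + s); last by lia.
rewrite (_ : 2 * j + s + 6 = 2 * (j + 3) + s); last by lia.
rewrite /general_position4 /noncollinear !VE !full3 rV.2.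
have D := det j.
rewrite D /=; apply/and3P; split.
- rewrite (_ : det3 _ _ _ = det3 (V j) (V (j + 1)) (V (j + 2))) //.
  by rewrite !det3E !mxE; ring.
- rewrite (_ : det3 _ _ _ = - z.1 j * det3 (V j) (V (j + 1)) (V (j + 2))).
    by rewrite mulf_neq0 ?oppr_eq0.
  by rewrite !det3E !mxE; ring.
- rewrite (_ : det3 _ _ _ = z.2 j * det3 (V j) (V (j + 1)) (V (j + 2))).
    by rewrite mulf_neq0.
  by rewrite !det3E !mxE; ring.
Qed.

(** The vertices of the image are W_j = V_(j+2) + c_j V_j = V_(j+3) - b_j V_(j+1).
    The key relation W_(j+1) - W_j = d_j V_(j+1) shows at once that the W_j obey
    a normalised recurrence and what its coefficients are. *)
Lemma coords_pentagram s n A z : coords s n A z ->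
  (forall j, dsum z.1 z.2 j != 0) -> coords (s + 3) n (pentagram A) (pent z).
Proof.
move=> [[pb pc b0 c0] [V rV VE]] d0.
have det := recurrent_det c0 rV.
pose W j := V (j + 2) + z.2 j *: V j.
have WE j : W j = V (j + 3) - z.1 j *: V (j + 1).
  by rewrite rV.2 /W addrAC addrK.
have dW j : W (j + 1) = W j + dsum z.1 z.2 j *: V (j + 1).
  rewrite (WE j) /W /dsum (_ : j + 1 + 2 = j + 3); last by lia.
  by rewrite scalerDl [RHS]addrA subrK.
split.
  have [pb' pc'] := periodic_pent pb pc.
  by split=> // j; rewrite /= /pent_b /pent_c !mulf_neq0 ?invr_eq0.
have E3 j : z.2 j * det3 (V j) (V (j + 1)) (V (j + 2)) = det3 (W j) (V (j + 1)) (V (j + 2)).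
  by rewrite /W !det3E !mxE; ring.
exists W.
  split=> [|j].
    have -> : det3 (W 0) (W 1) (W 2) = det3 (W 0) (W (0 + 1)) (W (0 + 1 + 1)) by [].
    rewrite !dW.
    rewrite (_ : det3 _ _ _ = dsum z.1 z.2 0 * dsum z.1 z.2 (0 + 1) *
       det3 (W 0) (V (0 + 1)) (V (0 + 1 + 1))); last by rewrite !det3E !mxE; ring.
    rewrite -(addrA 0 1) (_ : 1 + 1 = 2 :> int) // -E3 !mulf_neq0 //.
  rewrite (_ : j + 3 = j + 2 + 1); last by lia.
  rewrite (dW (j + 2)) (_ : j + 2 + 1 = j + 3); last by lia.
  rewrite -[RHS]addrA; congr (W (j + 2) + _).
  have -> : V (j + 3) = W j + z.1 j *: V (j + 1) by rewrite WE subrK.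
  rewrite dW /= -(pent_dsum (d0 j)); move: (W j) (V (j + 1)) => u v.
  have E : pent_b z.1 z.2 j * dsum z.1 z.2 j =
    (pent_b z.1 z.2 j + pent_c z.1 z.2 j) * z.1 j.
    by rewrite pent_dsum // /pent_b divfK // mulrC.
  by rewrite !scalerDr !scalerA -E scalerDl [in RHS]addrAC.
move=> j; rewrite /pentagram.
rewrite (_ : 2 * j + (s + 3) - 3 = 2 * j + s); last by lia.
rewrite (_ : 2 * j + (s + 3) + 1 = 2 * (j + 2) + s); last by lia.
rewrite (_ : 2 * j + (s + 3) - 1 = 2 * (j + 1) + s); last by lia.
rewrite (_ : 2 * j + (s + 3) + 3 = 2 * (j + 3) + s); last by lia.
rewrite !VE.
have D := det j.
have D1 : det3 (V j) (V (j + 2)) (V (j + 1)) != 0.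
  rewrite (_ : det3 _ _ _ = - det3 (V j) (V (j + 1)) (V (j + 2))) ?oppr_eq0 //.
  by rewrite !det3E; ring.
apply: (meet_line (r := V (j + 2))) => //.
- rewrite rV.2 (_ : det3 _ _ _ = - z.2 j * det3 (V j) (V (j + 1)) (V (j + 2))).
    by rewrite mulf_neq0 ?oppr_eq0.
  by rewrite !det3E !mxE; ring.
- have : det3 (W j) (V (j + 1)) (V (j + 2)) != 0 by rewrite -E3 mulf_neq0.
  by case/det3_neq0.
- by rewrite /W addrC memv_add ?rpredZ ?memv_line.
- by rewrite WE addrC memv_add ?memv_line // -scaleNr rpredZ ?memv_line.
Qed.

End Lift.

(** * Corner invariants of a lifted polygon *)

Section Coord.
Context {R : realType}.
Implicit Types (A B : ptseq R) (z : (int -> R) * (int -> R)) (n : nat).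

Lemma has_parityP (s m : int) : has_parity (odd `|s|%N) m -> exists j, m = 2 * j + s.
Proof.
rewrite /has_parity => /eqP E; exists ((m - s) %/ 2)%Z; lia.
Qed.

Lemma has_parity_even (j : int) : has_parity false (2 * j).
Proof. by rewrite /has_parity; lia. Qed.

(** General position makes all three coefficients of V_(j+3) on the three previous
    vectors nonzero, and rescaling the representatives turns the first one into
    1. The monodromy maps the lift to another normalised lift of the shifted
    polygon, so it rescales it by a constant and b, c are periodic. *)
Lemma twisted_coords n A : twisted_ngon n false A -> exists z, coords 0 n A z.
Proof.
case=> pts [phi [kphi phiA]] gp.
pose v (j : int) := vpick (A (2 * j)).
have vA j : A (2 * j) = <[v j]>%VS by case: (is_point_line (pts _ (has_parity_even j))).
have gpv j : [/\ det3 (v j) (v (j + 1)) (v (j + 2)) != 0,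
  det3 (v j) (v (j + 1)) (v (j + 3)) != 0, det3 (v j) (v (j + 2)) (v (j + 3)) != 0
  & det3 (v (j + 1)) (v (j + 2)) (v (j + 3)) != 0].
  have := gp _ (has_parity_even j); rewrite /general_position4 /noncollinear.
  rewrite (_ : 2 * j + 2 = 2 * (j + 1)); last by lia.
  rewrite (_ : 2 * j + 4 = 2 * (j + 2)); last by lia.
  rewrite (_ : 2 * j + 6 = 2 * (j + 3)); last by lia.
  by rewrite !vA !full3 => /and4P[].
have /boolp.choice [t tE] j : exists t : R * R * R,
  v (j + 3) = t.1.1 *: v (j + 2) + t.1.2 *: v (j + 1) + t.2 *: v j
    /\ [/\ t.1.1 != 0, t.1.2 != 0 & t.2 != 0].
  have [d1 d2 d3 d4] := gpv j.
  exists (det3 (v j) (v (j + 1)) (v (j + 3)) / det3 (v j) (v (j + 1)) (v (j + 2)),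
     det3 (v j) (v (j + 3)) (v (j + 2)) / det3 (v j) (v (j + 1)) (v (j + 2)),
     det3 (v (j + 3)) (v (j + 1)) (v (j + 2)) / det3 (v j) (v (j + 1)) (v (j + 2))).
  split; first by rewrite /= [LHS](det3_expand _ d1) addrC addrA addrAC; congr (_ + _);
    rewrite addrC.
  rewrite /= !mulf_neq0 ?invr_eq0 //.
    rewrite (_ : det3 _ _ _ = det3 (v (j + 1)) (v (j + 2)) (v (j + 3))) //.
    by rewrite !det3E; ring.
  rewrite (_ : det3 _ _ _ = - det3 (v j) (v (j + 2)) (v (j + 3))) ?oppr_eq0 //.
  by rewrite !det3E; ring.
(* the rescaling that makes the coefficient of V_(j+2) equal to 1 *)
have [l [l0 lS]] : exists l : int -> R, l 0 = 1 /\ forall j,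
  l (j + 1) = l j / (t (j - 2)).1.1.
  apply: (int_two_sided_rec (f := fun j x => x / (t (j - 2)).1.1)
     (g := fun j x => x * (t (j - 2)).1.1)) => j x.
  by have [_ [t0 _ _]] := tE (j - 2); rewrite mulfK.
have ln0 j : l j != 0.
  move: j; apply: int_two_sided_ind => [|j lj|j]; first by rewrite l0 oner_neq0.
    by have [_ [t0 _ _]] := tE (j - 2); rewrite lS mulf_neq0 ?invr_eq0.
  by rewrite lS; apply: contraNneq => ->; rewrite mul0r.
pose V j := l j *: v j.
have VA j : A (2 * j) = <[V j]>%VS.
  rewrite vA /V; apply/eqP; rewrite eqEsubv -!memvE rpredZ ?memv_line // andbT.
  by rewrite -{1}[v j](scalerK (ln0 j)) rpredZ ?memv_line.
pose z := (fun j => l (j + 3) * (t j).1.2 / l (j + 1), fun j => l (j + 3) * (t j).2 / l j).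
have rV : recurrent z V.
  split=> [|j].
    rewrite (_ : det3 _ _ _ = l 0 * l 1 * l 2 * det3 (v 0) (v (0 + 1)) (v (0 + 2))).
      by have [d _ _ _] := gpv 0; rewrite !mulf_neq0.
    by rewrite !add0r /V !det3E !mxE; ring.
  rewrite {1}/V; have [-> [t0 _ _]] := tE j; rewrite !scalerDr !scalerA.
  congr (_ *: _ + _ *: _ + _ *: _); rewrite /= ?divfK //.
  rewrite (_ : j + 3 = j + 2 + 1); last by lia.
  by rewrite lS addrK divfK.
have c0 j : z.2 j != 0.
  by have [_ [_ _ t0]] := tE j; rewrite /= !mulf_neq0 ?invr_eq0.
have b0 j : z.1 j != 0.
  by have [_ [_ t0 _]] := tE j; rewrite /= !mulf_neq0 ?invr_eq0.
clearbody V z; have det := recurrent_det c0 rV.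
(* phi (V j) is a multiple k j of V (j + n); comparing the two recurrences
   shows that k is constant *)
have /boolp.choice [k kE] j : exists k, phi (V j) = k *: V (j + n%:Z).
  have : phi (V j) \in A (2 * (j + n%:Z)).
    rewrite (_ : 2 * (j + n%:Z) = 2 * j + (2 * n)%:Z); last by lia.
    rewrite phiA ?has_parity_even // memv_img // VA memv_line //.
  by rewrite VA => /vlineP.
have kn0 j : k j != 0.
  apply/eqP => k0; have := kE j; rewrite k0 scale0r -(linear0 phi) =>
    /(lker0P (introT eqP kphi)) V0.
  by have [] := det3_neq0 (det j); rewrite V0 eqxx.
have kz j : [/\ k (j + 3) = k (j + 2), z.1 (j + n%:Z) * k (j + 3) = z.1 j * k (j + 1)
    & z.2 (j + n%:Z) * k (j + 3) = z.2 j * k j].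
  have := kE (j + 3); rewrite (rV.2 j) !linearD !linearZ /= !kE.
  rewrite !(addrAC j _ n%:Z) rV.2 !scalerDr !scalerA.
  have D : det3 (V (j + n%:Z + 2)) (V (j + n%:Z + 1)) (V (j + n%:Z)) != 0.
    rewrite (_ : det3 _ _ _ = - det3 (V (j + n%:Z)) (V (j + n%:Z + 1)) (V (j + n%:Z + 2))).
      by rewrite oppr_eq0.
    by rewrite !det3E; ring.
  by case/(det3_inj D) => -> E1 E0; split; rewrite // mulrC.
have kc j : k (j + 1) = k j.
  have [+ _ _] := kz (j - 2).
  by rewrite subrK (_ : j - 2 + 3 = j + 1) //; lia.
have k3 j : k (j + 3) = k j by rewrite (_ : j + 3 = j + 1 + 1 + 1) ?kc //; lia.
exists z; split; last by exists V => // j; rewrite addr0.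
split=> // j.
- by have [_ + _] := kz j; rewrite k3 kc => /(mulIf (kn0 j)).
- by have [_ _] := kz j; rewrite k3 => /(mulIf (kn0 j)).
Qed.

(** All the points that enter the two cross ratios have explicit representatives in
    the basis V_i, V_(i+1), V_(i+2). *)
Lemma x_coordE n A z : coords 0 n A z ->
  (forall j, x_coord false A (2 * j) = z.2 (j - 1) / (z.1 (j - 2) * z.1 (j - 1))) /\
  (forall j, x_coord false A (2 * j + 1) = - z.1 (j - 1)).
Proof.
move=> [[pb pc b0 c0] [V rV VE0]].
have VE j : A (2 * j) = <[V j]>%VS by rewrite -VE0 addr0.
have det := recurrent_det c0 rV.
have main i : x_coord false A (2 * (i + 2)) = z.2 (i + 1) / (z.1 i * z.1 (i + 1)) /\
  x_coord false A (2 * (i + 2) + 1) = - z.1 (i + 1).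
  have i4 : 2 * (i + 2) - 4 = 2 * i by lia.
  have i2 : 2 * (i + 2) - 2 = 2 * (i + 1) by lia.
  have i'2 : 2 * (i + 2) + 2 = 2 * (i + 3) by lia.
  have i'4 : 2 * (i + 2) + 4 = 2 * (i + 4) by lia.
  rewrite /x_coord has_parity_even ifN; last by rewrite /has_parity; lia.
  rewrite addrK i4 i2 i'2 i'4 !VE.
  set p := V i; set q := V (i + 1); set r := V (i + 2).
  set b := z.1 i; set c := z.2 i; set b' := z.1 (i + 1); set c' := z.2 (i + 1).
  have d : det3 p q r != 0 by apply: det.
  have E3 : V (i + 3) = r + b *: q + c *: p by rewrite rV.2.
  have E4 : V (i + 4) = V (i + 3) + b' *: r + c' *: q.
    have := rV.2 (i + 1).
    rewrite (_ : i + 1 + 3 = i + 4); last by lia.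
    rewrite (_ : i + 1 + 2 = i + 3); last by lia.
    by rewrite (_ : i + 1 + 1 = i + 2) //; lia.
  have [bn cn b'n c'n] : [/\ b != 0, c != 0, b' != 0 & c' != 0] by split; rewrite ?b0 ?c0.
  have d34 : det3 (V (i + 3)) (V (i + 4)) r != 0.
    rewrite E4 E3 (_ : det3 _ _ _ = c * c' * det3 p q r) ?mulf_neq0 //.
    by rewrite !det3E !mxE; ring.
  have BE : meet (line <[p]> <[q]>) (line <[r]> <[V (i + 3)]>) = <[c *: p + b *: q]>%VS.
    apply: (meet_line (r := p)) => //.
    - by rewrite E3 (_ : det3 _ _ _ = - b * det3 p q r) ?mulf_neq0 ?oppr_eq0 // !det3E !mxE; ring.
    - have : det3 (c *: p + b *: q) q r != 0.
        by rewrite (_ : det3 _ _ _ = c * det3 p q r) ?mulf_neq0 // !det3E !mxE; ring.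
      by case/det3_neq0.
    - by rewrite memv_add ?rpredZ ?memv_line.
    - have -> : c *: p + b *: q = - r + V (i + 3).
        by rewrite E3 -addrA addKr addrC.
      by rewrite memv_add ?rpredN ?memv_line.
  have DE1 : (- (b' * c)) *: p + (c' - b' * b) *: q = - (1 + b') *: V (i + 3) + V (i + 4).
    by rewrite E4 E3; apply/rowP => k; rewrite !mxE; ring.
  have DE : meet (line <[p]> <[q]>) (line <[V (i + 3)]> <[V (i + 4)]>) =
      <[(- (b' * c)) *: p + (c' - b' * b) *: q]>%VS.
    apply: (meet_line (r := r)) => //.
    - by rewrite E3 (_ : det3 _ _ _ = det3 p q r) // !det3E !mxE; ring.
    - have : det3 ((- (b' * c)) *: p + (c' - b' * b) *: q) q r != 0.
        rewrite (_ : det3 _ _ _ = - b' * c * det3 p q r) ?mulf_neq0 ?oppr_eq0 //.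
        by rewrite !det3E !mxE; ring.
      by case/det3_neq0.
    - by rewrite memv_add ?rpredZ ?memv_line.
    - by rewrite DE1 memv_add ?rpredZ ?memv_line.
  have CE : meet (line <[q]> <[r]>) (line <[V (i + 3)]> <[V (i + 4)]>) =
      <[(- V (i + 3) + V (i + 4))%R]>%VS.
    have CE1 : - V (i + 3) + V (i + 4) = c' *: q + b' *: r.
      by rewrite E4 -addrA addKr addrC.
    apply: (meet_line (r := r)) => //.
    - by rewrite E3 (_ : det3 _ _ _ = c * det3 p q r) ?mulf_neq0 // !det3E !mxE; ring.
    - have : det3 p (c' *: q + b' *: r) r != 0.
        by rewrite (_ : det3 _ _ _ = c' * det3 p q r) ?mulf_neq0 // !det3E !mxE; ring.
      by rewrite CE1 => /det3_neq0[].
    - by rewrite CE1 memv_add ?rpredZ ?memv_line.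
    - by rewrite memv_add ?rpredN ?memv_line.
  rewrite BE DE CE /chi; split.
    have := @cross_ratioE _ p q r 0 1 1 0 c b (- (b' * c)) (c' - b' * b) d.
    rewrite !scale0r !scale1r !add0r !addr0 !mul0r !mul1r ?mulr0 ?mulr1 ?subr0 ?sub0r => ->.
    - by field; rewrite bn cn b'n.
    - by rewrite oppr_eq0 oner_neq0.
    - by rewrite bn.
    - by rewrite oppr_eq0 mulf_neq0.
    - rewrite (_ : _ - _ = c * c') ?mulf_neq0 //; ring.
  rewrite DE1.
  have := @cross_ratioE _ (V (i + 3)) (V (i + 4)) r 1 0 0 1 (-1) 1 (- (1 + b')) 1 d34.
  rewrite !scale0r !scale1r !add0r !addr0 !scaleN1r => ->.
  - by field.
  - by rewrite mul0r subr0 mulr1 oner_neq0.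
  - by rewrite mul0r sub0r mul1r opprK oner_neq0.
  - by rewrite mulr0 sub0r mulr1 oppr_eq0 oner_neq0.
  - rewrite (_ : _ - _ = b') //; ring.
by split=> j; have := main (j - 2); rewrite subrK (_ : j - 2 + 1 = j - 1);
  do ?[by case | lia].
Qed.

End Coord.

(** * Change of coordinates and regular functions *)

Lemma periodicM (T : fieldType) n (f : int -> T) : periodic n f ->
  forall j k, f (j + k * n%:Z) = f j.
Proof.
move=> pf j; apply: int_two_sided_ind => [|k <-|k]; first by rewrite mul0r addr0.
  by rewrite mulrDl mul1r addrA pf.
by rewrite mulrDl mul1r addrA pf.
Qed.

Section Coordinates.
Context {R : realType} (n : nat).
Hypothesis n0 : (0 < n)%N.
Implicit Types (z : (int -> R) * (int -> R)) (v : 'I_(2 * n) -> R).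

Definition res (j : int) : nat := `|(j %% n%:Z)%Z|%N.

Lemma resE j : (res j)%:Z = j - (j %/ n%:Z)%Z * n%:Z.
Proof.
rewrite /res gez0_abs; last by apply: modz_ge0; lia.
by have := divz_eq j n; lia.
Qed.

Lemma res_lt j : (res j < n)%N.
Proof.
have := ltz_pmod j (d := n%:Z); have := modz_ge0 j (d := n%:Z); rewrite /res; lia.
Qed.

Lemma periodic_res (f : int -> R) j k : periodic n f -> f ((res j)%:Z + k) = f (j + k).
Proof.
by move=> pf; rewrite resE -mulNr addrAC periodicM.
Qed.

Lemma periodic_res0 (f : int -> R) j : periodic n f -> f (res j)%:Z = f j.
Proof. by move=> pf; have := periodic_res j 0 pf; rewrite !addr0. Qed.

Lemma idx_even_lt j : (2 * res j < 2 * n)%N. Proof. by have := res_lt j; lia. Qed.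
Lemma idx_odd_lt j : ((2 * res j).+1 < 2 * n)%N. Proof. by have := res_lt j; lia. Qed.
Definition idx_even j := Ordinal (idx_even_lt j).
Definition idx_odd j := Ordinal (idx_odd_lt j).

(** The coefficients (b, c) as polynomials in the corner invariants; [xv] is the
    inverse change of coordinates. *)
Definition zb v (j : int) := - v (idx_even (j + 1)).
Definition zc v (j : int) := v (idx_odd j) * (zb v (j - 1) * zb v j).
Definition zv v := (zb v, zc v).
Definition xv z : 'I_(2 * n) -> R := fun i =>
  if odd i then z.2 (i./2)%:Z / (z.1 ((i./2)%:Z - 1) * z.1 (i./2)%:Z)
  else - z.1 ((i./2)%:Z - 1).

Lemma zv_nondeg v : (forall i, v i != 0) -> nondeg n (zv v).
Proof.
move=> v0.
have pb : periodic n (zb v).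
  move=> j; rewrite /zb; congr (- v _); apply: val_inj => /=.
  by rewrite addrAC /res modzDr.
have b0 j : zb v j != 0 by rewrite oppr_eq0.
split=> // j; rewrite /= /zc; last by rewrite !mulf_neq0.
rewrite addrAC !pb; congr (v _ * _); apply: val_inj => /=.
by rewrite /res modzDr.
Qed.

Lemma xvK z : nondeg n z -> zv (xv z) = z.
Proof.
move=> [pb pc b0 c0].
have Eb j : zb (xv z) j = z.1 j.
  rewrite /zb /xv /= mul2n odd_double half_double opprK periodic_res //.
  by rewrite addrK.
rewrite [RHS]surjective_pairing; congr pair; apply: funext => j; first exact: Eb.
rewrite /zc !Eb /xv /= mul2n odd_double /= uphalf_double.
by rewrite !periodic_res // !periodic_res0 // divfK // mulf_neq0.
Qed.

Lemma xv_neq0 z : nondeg n z -> forall i, xv z i != 0.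
Proof.
move=> [pb pc b0 c0] i; rewrite /xv; case: ifP => _; rewrite ?oppr_eq0 //.
by rewrite !mulf_neq0 ?invr_eq0 ?mulf_neq0.
Qed.

Lemma x_vecE A z : coords 0 n A z -> @x_vec R n false A = xv z.
Proof.
move=> H; have [Ee Eo] := x_coordE H; apply: funext => i.
rewrite /x_vec /xv; case: ifP => oi.
  rewrite (_ : (i.+1)%:Z = 2 * ((i./2)%:Z + 1)); last by lia.
  rewrite Ee addrK; congr (_ / (z.1 _ * _)); lia.
by rewrite (_ : (i.+1)%:Z = 2 * (i./2)%:Z + 1) ?Eo //; lia.
Qed.

Lemma coords_zv A z : coords 0 n A z -> z = zv (@x_vec R n false A).
Proof. by move=> H; rewrite (x_vecE H) xvK //; case: H. Qed.

Lemma twisted_coords_zv A : twisted_ngon n false A ->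
  coords 0 n A (zv (@x_vec R n false A)).
Proof. by case/twisted_coords => z H; rewrite -(coords_zv H). Qed.

Lemma twisted_x_neq0 A : twisted_ngon n false A -> forall i, @x_vec R n false A i != 0.
Proof. by case/twisted_coords => z H; rewrite (x_vecE H); apply: xv_neq0; case: H. Qed.

(** In the coordinates (b, c), y_(2i) is the quotient b_(i-2) / c_(i-1), so that X_S
    is cut out by linear equations. *)
Lemma y_coordE A z i : coords 0 n A z ->
  y_coord A (2 * i) = -1 <-> dsum z.1 z.2 (i - 2) = 0.
Proof.
move=> H; have [Ee Eo] := x_coordE H; have [[pb pc b0 c0] _] := H.
rewrite /y_coord has_parity_even Ee Eo.
have -> : - (z.2 (i - 1) / (z.1 (i - 2) * z.1 (i - 1)) * - z.1 (i - 1))^-1 =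
  z.1 (i - 2) / z.2 (i - 1).
  by field; rewrite !b0 c0.
rewrite /dsum (_ : i - 2 + 1 = i - 1); last by lia.
split=> [E|/eqP].
  by rewrite -[z.1 _](divfK (c0 (i - 1))) E mulN1r addNr.
by rewrite addr_eq0 => /eqP ->; rewrite mulNr divff.
Qed.

Lemma polyf_zb j : polyf (fun v => (zv v).1 j).
Proof. by apply: polyfN; apply: polyf_coord. Qed.
Lemma polyf_zc j : polyf (fun v => (zv v).2 j).
Proof. by apply: polyfM; [apply: polyf_coord|apply: polyfM; apply: polyf_zb]. Qed.

Definition regular_on (D : ('I_(2 * n) -> R) -> Prop) (F : ('I_(2 * n) -> R) -> R) :=
  exists f g : {mpoly R[2 * n]}, forall v, D v -> g.@[v] != 0 /\ F v = f.@[v] / g.@[v].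

Lemma regular_on_poly D F : polyf F -> regular_on D F.
Proof. by case=> p E; exists p, 1 => v _; rewrite meval1 divr1 oner_neq0. Qed.
Lemma regular_on_mpoly D (p : {mpoly R[2 * n]}) : regular_on D (fun v => p.@[v]).
Proof. by apply: regular_on_poly; exists p. Qed.
Lemma regular_onS D D' F : (forall v, D' v -> D v) -> regular_on D F -> regular_on D' F.
Proof. by move=> DD [f [g H]]; exists f, g => v /DD /H. Qed.
Lemma regular_onN D F : regular_on D F -> regular_on D (fun v => - F v).
Proof. by case=> f [g H]; exists (- f), g => v /H [g0 ->]; rewrite mevalN mulNr. Qed.
Lemma regular_onM D F G : regular_on D F -> regular_on D G ->
  regular_on D (fun v => F v * G v).
Proof.
case=> f [g H] [f' [g' H']]; exists (f * f'), (g * g') => v Dv.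
have [g0 ->] := H v Dv; have [g0' ->] := H' v Dv.
by rewrite !mevalM mulf_neq0 // mulf_div.
Qed.
Lemma regular_onD D F G : regular_on D F -> regular_on D G ->
  regular_on D (fun v => F v + G v).
Proof.
case=> f [g H] [f' [g' H']]; exists (f * g' + f' * g), (g * g') => v Dv.
have [g0 ->] := H v Dv; have [g0' ->] := H' v Dv.
by rewrite mevalD !mevalM mulf_neq0 // addf_div.
Qed.
Lemma regular_onV D F : (forall v, D v -> F v != 0) -> regular_on D F ->
  regular_on D (fun v => (F v)^-1).
Proof.
move=> F0 [f [g H]]; exists g, f => v Dv; have [g0 E] := H v Dv.
have := F0 v Dv; rewrite E mulf_eq0 negb_or => /andP[f0 _].
by rewrite invf_div.
Qed.

Definition nowhere0 v := forall i, v i != 0.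

(** No division by 0 occurs in the first k steps. *)
Definition regular_upto k z := forall i j, (i < k)%N ->
  dsum (iter i pent z).1 (iter i pent z).2 j != 0.

Lemma nondeg_pent z : nondeg n z -> (forall j, dsum z.1 z.2 j != 0) -> nondeg n (pent z).
Proof.
move=> [pb pc b0 c0] d0; have [pb' pc'] := periodic_pent pb pc.
by split=> // j; rewrite /= /pent_b /pent_c !mulf_neq0 ?invr_eq0.
Qed.

Lemma nondeg_iter k z : nondeg n z -> regular_upto k z -> nondeg n (iter k pent z).
Proof.
move=> nz; elim: k => // k IH ok /=; apply: nondeg_pent.
  by apply: IH => i j ik; apply: ok; apply: ltnW.
by move=> j; apply: ok.
Qed.

Lemma periodic_dsum z : nondeg n z -> periodic n (dsum z.1 z.2).
Proof. by move=> [pb pc _ _] j; rewrite /dsum pb addrAC pc. Qed.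

Lemma coords_iter k A z : coords 0 n A z -> regular_upto k z ->
  coords (k%:Z * 3) n (iter k pentagram A) (iter k pent z).
Proof.
move=> H; elim: k => [|k IH] ok /=; first by rewrite mul0r.
rewrite -addn1 PoszD mulrDl mul1r; apply: coords_pentagram; last by move=> j; apply: ok.
by apply: IH => i j ik; apply: ok; apply: ltnW.
Qed.

(** A fixed point of the map on coefficients, which shows that the iterates are
    defined on a dense set. *)
Definition ones : (int -> R) * (int -> R) := (fun=> 1, fun=> 1).

Lemma nondeg_ones : nondeg n ones.
Proof. by split=> // j; rewrite oner_neq0. Qed.

Lemma iter_pent_ones k : iter k pent ones = ones.
Proof.
elim: k => //= k ->; rewrite /pent /=.
have d : 1 + 1 != 0 :> R by rewrite -(natrD _ 1 1) pnatr_eq0.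
by congr pair; apply: funext => j; rewrite /pent_b /pent_c /dsum /= mul1r divff.
Qed.

(** Each step divides by the d_j, which are rational functions of the corner
    invariants: their numerators are collected in H. *)
Lemma iterates_regular_open k : exists H : {mpoly R[2 * n]}, [/\ H.@[xv ones] != 0,
  forall v, nowhere0 v -> H.@[v] != 0 -> regular_upto k (zv v) &
  let D v := nowhere0 v /\ H.@[v] != 0 in
  forall j, regular_on D (fun v => (iter k pent (zv v)).1 j) /\
            regular_on D (fun v => (iter k pent (zv v)).2 j)].
Proof.
elim: k => [|k [H [H1 ok rat]]].
  exists 1; split=> [||D j]; rewrite ?meval1 ?oner_neq0 //.
  by split; apply: regular_on_poly; [apply: polyf_zb|apply: polyf_zc].
pose D v := nowhere0 v /\ H.@[v] != 0.
have rd j : regular_on D (fun v => dsum (iter k pent (zv v)).1 (iter k pent (zv v)).2 j).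
  by apply: regular_onD; [case: (rat j)|case: (rat (j + 1))].
have [f fE] := boolp.choice rd.
pose H' := H * \prod_(j < n) f j%:Z.
have H'P v : H'.@[v] != 0 -> H.@[v] != 0 /\ forall j : 'I_n, (f j%:Z).@[v] != 0.
  rewrite mevalM mulf_eq0 negb_or rmorph_prod /= => /andP[-> h]; split=> // j.
  by move/prodf_neq0: h; apply.
have dn0 v : nowhere0 v -> H'.@[v] != 0 ->
    forall j, dsum (iter k pent (zv v)).1 (iter k pent (zv v)).2 j != 0.
  move=> gv /H'P [Hv fv] j.
  have nd := nondeg_iter (zv_nondeg gv) (ok v gv Hv).
  rewrite -(periodic_res0 j (periodic_dsum nd)).
  have [g gE] := fE (res j)%:Z; have [g0 ->] := gE v (conj gv Hv).
  by rewrite mulf_neq0 ?invr_eq0 // (fv (Ordinal (res_lt j))).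
have sub v : nowhere0 v /\ H'.@[v] != 0 -> D v by case=> gv /H'P [].
exists H'; split.
- rewrite mevalM mulf_neq0 // rmorph_prod /=; apply/prodf_neq0 => j _.
  have [g gE] := fE j%:Z.
  have [g0 E] := gE (xv ones) (conj (xv_neq0 nondeg_ones) H1).
  apply/negP => /eqP f0; move: E; rewrite f0 mul0r xvK ?iter_pent_ones;
    last exact: nondeg_ones.
  by move/eqP; rewrite /dsum /= -(natrD _ 1 1) pnatr_eq0.
- move=> v gv Hv i j; rewrite ltnS leq_eqVlt => /predU1P [->|ik]; first exact: dn0.
  by have [Hv0 _] := H'P v Hv; apply: ok.
- have rd' j := regular_onS sub (rd j).
  have rdV j : regular_on (fun v => nowhere0 v /\ H'.@[v] != 0)
      (fun v => (dsum (iter k pent (zv v)).1 (iter k pent (zv v)).2 j)^-1).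
    by apply: regular_onV => // v [gv Hv]; apply: dn0.
  move=> D' j; split; apply: regular_onM => //; apply: regular_onM => //;
    apply: (regular_onS sub).
    by case: (rat j).
  by case: (rat (j + 1)).
Qed.

End Coordinates.

(** * Segments in the coefficient space *)

Section Pencil.
Context {R : realType} (n : nat).
Hypothesis n0 : (0 < n)%N.
Implicit Types (z : (int -> R) * (int -> R)) (D P : {poly R}) (f g : R -> R).

Lemma poly_nonroot (p : {poly R}) : p != 0 -> exists t, p.[t] != 0.
Proof.
move=> p0; apply: contrapT => H.
have all0 t : root p t by apply/negPn/negP => r; apply: H; exists t.
have := max_poly_roots (rs := [seq i%:R | i <- iota 0 (size p)]) p0.
rewrite size_map size_iota ltnn; move=> K; apply: notF; apply: K.
  by apply/allP => t _.
by rewrite map_inj_uniq ?iota_uniq // => i j /eqP; rewrite eqr_nat => /eqP.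
Qed.

Definition localized D f := exists P m, forall t, D.[t] != 0 -> f t * D.[t] ^+ m = P.[t].

Lemma localized_const D a : localized D (fun=> a).
Proof. by exists a%:P, 0%N => t _; rewrite hornerC mulr1. Qed.
Lemma localizedD D f g : localized D f -> localized D g -> localized D (fun t => f t + g t).
Proof.
case=> P [m H] [P' [m' H']]; exists (P * D ^+ m' + P' * D ^+ m), (m + m')%N => t Dt.
by rewrite hornerD !hornerM !horner_exp -H // -H' // exprD; ring.
Qed.
Lemma localizedM D f g : localized D f -> localized D g -> localized D (fun t => f t * g t).
Proof.
case=> P [m H] [P' [m' H']]; exists (P * P'), (m + m')%N => t Dt.
by rewrite hornerM -H // -H' // exprD mulrACA.
Qed.
Lemma localized_meval D k (x : R -> 'I_k -> R) (h : {mpoly R[k]}) :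
  (forall i, localized D (x^~ i)) -> localized D (fun t => h.@[x t]).
Proof.
move=> Hx; under eq_fun do rewrite mevalE.
elim: (msupp h) => [|m s IH]; first by under eq_fun do rewrite big_nil;
  exact: localized_const.
under eq_fun do rewrite big_cons; apply: localizedD => //.
apply: localizedM; first exact: localized_const.
elim: (index_enum _) => [|i r IHr]; first by under eq_fun do rewrite big_nil;
  exact: localized_const.
under eq_fun do rewrite big_cons; apply: localizedM => //.
elim: (m i) => [|e IHe]; first by under eq_fun do rewrite expr0; exact: localized_const.
by under eq_fun do rewrite exprS; apply: localizedM.
Qed.

(** The segment between two points of a linear space in the coordinates (b, c)
    stays in that space, and a nonzero polynomial on it has finitely many zeros:
    two nonempty principal open subsets of X_S intersect. *)
Lemma pencil_dense z z' (h h' : {mpoly R[2 * n]}) : nondeg n z -> nondeg n z' ->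
  h.@[xv z] != 0 -> h'.@[xv z'] != 0 ->
  exists w, [/\ nondeg n w, h.@[xv w] != 0, h'.@[xv w] != 0 &
    forall j, dsum z.1 z.2 j = 0 -> dsum z'.1 z'.2 j = 0 -> dsum w.1 w.2 j = 0].
Proof.
move=> nz nz' hz hz'.
pose L (a b : R) : {poly R} := a%:P + (b - a) *: 'X.
have LE a b t : (L a b).[t] = a + (b - a) * t.
  by rewrite /L hornerD hornerC hornerZ hornerX.
pose pb j := L (z.1 j) (z'.1 j); pose pc j := L (z.2 j) (z'.2 j).
pose w t : (int -> R) * (int -> R) := (fun j => (pb j).[t], fun j => (pc j).[t]).
have w0 : w 0 = z.
  by rewrite [z]surjective_pairing /w; congr pair; apply: funext => j;
    rewrite LE mulr0 addr0.
have w1 : w 1 = z'.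
  by rewrite [z']surjective_pairing /w; congr pair; apply: funext => j;
    rewrite LE mulr1 addrC subrK.
have [b_per c_per bn cn] := nz; have [b_per' c_per' bn' cn'] := nz'.
have perb t : periodic n (w t).1 by move=> j; rewrite /= !LE b_per b_per'.
have perc t : periodic n (w t).2 by move=> j; rewrite /= !LE c_per c_per'.
pose D := \prod_(j < n) (pb j%:Z * pc j%:Z).
have DE t : D.[t] = \prod_(j < n) ((w t).1 j%:Z * (w t).2 j%:Z).
  by rewrite /D horner_prod; apply: eq_bigr => j _; rewrite hornerM.
have nd t : D.[t] != 0 -> nondeg n (w t).
  rewrite DE => /prodf_neq0 H; split=> // j.
    rewrite -(periodic_res0 n0 j (perb t)).
    by have := H (Ordinal (res_lt n0 j)) isT; rewrite mulf_eq0 negb_or => /andP[].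
  rewrite -(periodic_res0 n0 j (perc t)).
  by have := H (Ordinal (res_lt n0 j)) isT; rewrite mulf_eq0 negb_or => /andP[].
have D0 : D.[0] != 0.
  by rewrite DE w0; apply/prodf_neq0 => j _; rewrite mulf_neq0.
have Dp : D != 0 by apply: contraNneq D0 => ->; rewrite horner0.
have binv j : localized D (fun t => ((w t).1 j)^-1).
  pose r := Ordinal (res_lt n0 j).
  exists ((pc r%:Z) * \prod_(i < n | i != r) (pb i%:Z * pc i%:Z)), 1%N => t Dt.
  have [_ _ bt _] := nd t Dt.
  rewrite -(periodic_res0 n0 j (perb t)) expr1 /D (bigD1 r) //= 2!hornerM [in RHS]hornerM.
  by rewrite -!mulrA mulKf //; exact: (bt (res n j)%:Z).
have wb j : localized D (fun t => (w t).1 j).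
  by exists (pb j), 0%N => t _; rewrite mulr1.
have wc j : localized D (fun t => (w t).2 j).
  by exists (pc j), 0%N => t _; rewrite mulr1.
have wx i : localized D (fun t => xv (n := n) (w t) i).
  case oi: (odd i); rewrite /xv oi.
    rewrite (_ : (fun t => _) = fun t => (w t).2 (i./2)%:Z *
      (((w t).1 ((i./2)%:Z - 1))^-1 * ((w t).1 (i./2)%:Z)^-1)).
      by apply: localizedM; [exact: wc|apply: localizedM; exact: binv].
    by apply: funext => t; rewrite invfM.
  rewrite (_ : (fun t => _) = fun t => -1 * (w t).1 ((i./2)%:Z - 1)); last first.
    by apply: funext => t; rewrite mulN1r.
  by apply: localizedM; [exact: localized_const|exact: wb].
have [P [m HP]] := localized_meval h wx; have [P' [m' HP']] := localized_meval h' wx.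
have Pn : P != 0.
  apply: contraNneq hz => P0; have := HP 0 D0; rewrite P0 horner0 w0 => /eqP.
  by rewrite mulf_eq0 expf_eq0 (negbTE D0) andbF orbF.
have D1 : D.[1] != 0.
  by rewrite DE w1; apply/prodf_neq0 => j _; rewrite mulf_neq0.
have Pn' : P' != 0.
  apply: contraNneq hz' => P0; have := HP' 1 D1; rewrite P0 horner0 w1 => /eqP.
  by rewrite mulf_eq0 expf_eq0 (negbTE D1) andbF orbF.
have [t] := @poly_nonroot (D * P * P') (mulf_neq0 (mulf_neq0 Dp Pn) Pn').
rewrite !hornerM !mulf_eq0 !negb_or => /andP[/andP[Dt Pt] Pt'].
exists (w t); split.
- exact: nd.
- by apply: contraNneq Pt => h0; rewrite -HP // h0 mul0r.
- by apply: contraNneq Pt' => h0; rewrite -HP' // h0 mul0r.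
- move=> j; rewrite /dsum /= !LE => E E'.
  transitivity ((z.1 j + z.2 (j + 1)) * (1 - t) + (z'.1 j + z'.2 (j + 1)) * t);
    first by ring.
  by rewrite E E' !mul0r addr0.
Qed.

End Pencil.

(** * Singularity confinement *)

Section Main.
Context {R : realType} (n : nat).
Hypothesis nodd : odd n.
Notation n0 := (odd_gt0 nodd).
Implicit Types (z : (int -> R) * (int -> R)) (v : 'I_(2 * n) -> R) (A B : ptseq R).
Notation zv := (zv n0).

(** At a point where d vanishes away from one class modulo n, rho is the quotient of
    two polynomials that do not vanish there, although the iteration that defines
    rho may break down at this point. *)
Lemma rho_rational z0 j0 w j : nondeg n z0 ->
  (forall i, (dsum z0.1 z0.2 i != 0) = (n%:Z %| i - j0)%Z) ->
  w = n \/ w = n.+1 ->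
  exists pq : {mpoly R[2 * n]} * {mpoly R[2 * n]},
  [/\ pq.1.@[xv z0] != 0, pq.2.@[xv z0] != 0 & forall v, regular_upto w (zv v) ->
    rho (zv v) w j * pq.2.@[v] = pq.1.@[v]].
Proof.
move=> nz dP wn; have [pb pc b0 c0] := nz.
have [||h H hw corner|p [q [p0 q0 pq]]] := @strip_ratio R (2 * n) w
    (fun v => (zv v).1) (fun v => (zv v).2) (j + w%:Z) (xv z0).
- exact: polyf_zb.
- exact: polyf_zc.
- rewrite xvK // in H; apply: (strip_corner b0 c0 _ H hw corner) => q' h' H' hw'.
  by case: wn H' hw' => -> H' hw'; [apply: (strip_zero nodd c0 dP H')
    |apply: (strip_zero_succ nodd pc pb c0 dP H')].
exists (p, q); split=> // v ok.
have [h [H hw h1 hr]] := strip_exists j (fun i k => @ok i k).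
by have := pq v h H hw; rewrite h1 hr mul1r.
Qed.

(** An even offset amounts to a renumbering of the lift. *)
Lemma coords_even_shift k A z : coords (2 * k) n A z ->
  coords 0 n A (fun j => z.1 (j - k), fun j => z.2 (j - k)).
Proof.
move=> [[pb pc b0 c0] [V rV VE]]; split.
  by split=> //= j; rewrite addrAC ?pb ?pc.
exists (fun j => V (j - k)); first exact: recurrent_shift.
by move=> j; rewrite -VE; congr A; lia.
Qed.

Definition principal_open (h : {mpoly R[2 * n]}) : set (ptseq R) :=
  [set A | twisted_ngon n false A /\ h.@[@x_vec R n false A] != 0]%classic.

Lemma principal_openP h : zariski_open n false (principal_open h).
Proof.
exists [set h]%classic; apply/seteqP; split=> A /=.
  by case=> tA hA; split=> //; exists h.
by case=> tA [_ ->].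
Qed.

(** X_S is irreducible, so one point of X_S outside the zero set of h is enough. *)
Lemma principal_open_dense (S : set int) h z0 : nondeg n z0 -> h.@[xv z0] != 0 ->
  (forall i, S i -> dsum z0.1 z0.2 (i - 2) = 0) ->
  zariski_dense_in n false (X_set n S) (principal_open h).
Proof.
move=> nz0 hz0 S0 W [H ->] [A [[tA [g Hg gA]] [_ yA]]].
have HA := twisted_coords_zv n0 tA; set z := zv _ in HA.
have [nz _] := HA; rewrite (x_vecE n0 HA) in gA.
have [w [nw gw hw dw]] := pencil_dense n0 nz nz0 gA hz0.
have [B HB] := coords_exists 0 nw; exists B.
have tB : twisted_ngon n false B by apply: coords_twisted HB => m; exact: (@has_parityP 0).
split; first by split=> //; exists g => //; rewrite (x_vecE n0 HB).
split; first by split; rewrite // (x_vecE n0 HB).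
split=> // i Si; apply/(y_coordE n0 _ HB); apply: dw; last exact: S0.
by apply/(y_coordE n0 _ HA); apply: yA.
Qed.

Lemma coords_iterates_defined k A z : coords 0 n A z -> regular_upto k z ->
  iterates_defined n k A.
Proof.
move=> HA ok i ik.
have H := coords_iter (k := i) HA (fun a b ab => ok a b (leq_trans ab ik)).
apply: coords_twisted H => m hm; apply: has_parityP.
by rewrite (_ : odd _ = odd i) //; lia.
Qed.

(** The product of the numerators and denominators of rho for the two widths that
    the iterate n + 1 involves, over all residues of the base index. *)
Definition corner_minors (p q : nat -> int -> {mpoly R[2 * n]}) :=
  \prod_(j < n) (p n j%:Z * q n j%:Z * p n.+1 j%:Z * q n.+1 j%:Z).

(** By [iter_pent_b] and [iter_pent_c] the iterate n + 1 is given by quotients of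
    rho n and rho (n + 1). Replacing rho by p / q yields formulas that make sense
    wherever the polynomials p and q do not vanish, and that agree with the
    iteration where the latter is defined. *)
Lemma nonsingular_corner_minors (p q : nat -> int -> {mpoly R[2 * n]}) A :
  principal_open (corner_minors p q) A ->
  (forall w j v, (n <= w <= n.+1)%N -> regular_upto w (zv v) ->
     rho (zv v) w j * (q w j).@[v] = (p w j).@[v]) ->
  nonsingular n n.+1 A.
Proof.
move=> UA pq.
pose P w j := p w (res n j)%:Z; pose Q w j := q w (res n j)%:Z.
have rP w j : P w (j + n%:Z) = P w j by rewrite /P /res modzDr.
have rQ w j : Q w (j + n%:Z) = Q w j by rewrite /Q /res modzDr.
pose h := corner_minors p q.
have hP v : h.@[v] != 0 -> forall j, [/\ (P n j).@[v] != 0, (Q n j).@[v] != 0,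
  (P n.+1 j).@[v] != 0 & (Q n.+1 j).@[v] != 0].
  rewrite /h rmorph_prod => /prodf_neq0 hv j.
  have := hv (Ordinal (res_lt n0 j)) isT; rewrite /= !mevalM !mulf_eq0 !negb_or.
  by move=> /andP[/andP[/andP[-> ->] ->] ->].
pose nb v j := (zv v).1 j * ((P n.+1 j).@[v] * (Q n (j + 1)).@[v])
    * ((zv v).2 (j + 1) * ((Q n.+1 j).@[v] * (P n (j + 1)).@[v]))^-1.
pose nc v j := ((P n.+1 j).@[v] * (Q n j).@[v]) * ((Q n.+1 j).@[v] * (P n j).@[v])^-1.
pose D v := nowhere0 v /\ h.@[v] != 0.
have nd v : D v -> nondeg n (nb v, nc v).
  move=> [gv hv]; have [pb pc b0 c0] := zv_nondeg n0 gv.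
  split=> j; rewrite /= /nb /nc.
  - by rewrite addrAC !rP !rQ pb pc.
  - by rewrite !rP !rQ.
  - have [_ _ ? ?] := hP v hv j; have [? ? _ _] := hP v hv (j + 1).
    by rewrite !mulf_neq0 ?invr_eq0 ?mulf_neq0 ?b0 ?c0.
  - have [? ? ? ?] := hP v hv j.
    by rewrite !mulf_neq0 ?invr_eq0 ?mulf_neq0.
have rnb j : regular_on D (fun v => nb v j).
  apply: regular_onM; first apply: regular_onM; first by apply: regular_on_poly;
    exact: polyf_zb.
    by apply: regular_onM; apply: regular_on_mpoly.
  apply: regular_onV => [v [gv hv]|].
    have [pb pc b0 c0] := zv_nondeg n0 gv.
    have [_ _ ? ?] := hP v hv j; have [? ? _ _] := hP v hv (j + 1).
    by apply: mulf_neq0; [exact: c0|rewrite mulf_neq0].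
  by apply: regular_onM; [apply: regular_on_poly; exact: polyf_zc|apply: regular_onM;
    apply: regular_on_mpoly].
have rnc j : regular_on D (fun v => nc v j).
  apply: regular_onM; first by apply: regular_onM; apply: regular_on_mpoly.
  apply: regular_onV => [v [gv hv]|]; last by apply: regular_onM; apply: regular_on_mpoly.
  by have [? ? ? ?] := hP v hv j; rewrite mulf_neq0.
have DU B : principal_open h B -> D (@x_vec R n false B).
  by case=> tB hB; split => //; exact: @twisted_x_neq0 R n n0 B tB.
have oddS : odd n.+1 = false by rewrite /= nodd.
have /boolp.choice [F FE] B : exists B', principal_open h B ->
    coords (n.+1%:Z * 3) n B' (nb (@x_vec R n false B), nc (@x_vec R n false B)).
  have [/DU DB|nB] := pselect (principal_open h B); last by exists B.
  by have [B' HB'] := coords_exists (n.+1%:Z * 3) (nd _ DB); exists B'.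
(* n + 1 steps increase the offset of the doubled indices by 3 (n + 1), which is
   even because n is odd *)
pose k := (n.+1./2)%:Z * 3.
have kE : n.+1%:Z * 3 = 2 * k by rewrite /k; lia.
have FE0 B : principal_open h B -> coords 0 n (F B)
    (fun j => nb (@x_vec R n false B) (j - k), fun j => nc (@x_vec R n false B) (j - k)).
  by move=> /FE; rewrite kE => /coords_even_shift.
exists (principal_open h), F; split.
- exact: principal_openP.
- by [].
- rewrite oddS; split.
    by move=> B /FE0 HB; apply: coords_twisted HB => m; exact: (@has_parityP 0).
  have rat i : regular_on D (fun v =>
      xv (n := n) (fun j => nb v (j - k), fun j => nc v (j - k)) i).
    case oi: (odd i); rewrite /xv oi /=; last by apply: regular_onN; exact: rnb.
    apply: regular_onM; first exact: rnc.
    apply: regular_onV => [v Dv|]; last by apply: regular_onM; exact: rnb.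
    by have [_ _ b0 _] := nd v Dv; apply: mulf_neq0; exact: b0.
  have [f fE] := boolp.choice rat; have [g gE] := boolp.choice fE.
  exists f, g => B UB j; rewrite (x_vecE n0 (FE0 B UB)); exact: gE (DU B UB).
have [H [H1 ok _]] := @iterates_regular_open R n n0 n.+1.
exists (principal_open H); split.
- exact: principal_openP.
- have := @principal_open_dense set0 H ones (nondeg_ones n) H1 (fun i f => False_ind _ f).
  move=> + W WO [B [WB tB]] => /(_ W WO) [|C [WC [HC [tC _]]]]; last by exists C.
  by exists B; split.
move=> B [UB [tB HB]].
have gB := twisted_x_neq0 n0 tB.
have okB := ok _ gB HB; have cB := twisted_coords_zv n0 tB.
split; first exact: coords_iterates_defined cB okB.
have E : (nb (@x_vec R n false B), nc (@x_vec R n false B)) =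
  iter n.+1 pent (zv (@x_vec R n false B)).
  set v := x_vec _ _ in gB okB *.
  have [_ hv] := DU B UB; rewrite -/v in hv.
  have nz := zv_nondeg n0 gB.
  have ndi i : (i <= n.+1)%N -> nondeg n (iter i pent (zv v)).
    by move=> ile; apply: nondeg_iter => // a b ab; apply: okB; apply: leq_trans ab ile.
  have cn i l : (i <= n.+1)%N -> (iter i pent (zv v)).2 l != 0.
    by move=> /ndi [].
  have rhoE w j : (n <= w <= n.+1)%N -> rho (zv v) w j = (P w j).@[v] / (Q w j).@[v].
    move=> wn; have okw : regular_upto w (zv v) by move=> a b ab; apply: okB; lia.
    have per : periodic n (rho (zv v) w).
      move=> l; apply: eq_bigr => i _.
      have [_ pc _ _] := ndi i.+1 ltac:(have := ltn_ord i; lia).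
      exact: pc.
    rewrite -(periodic_res0 n0 j per) -(pq w (res n j)%:Z v wn okw) mulfK //.
    have [? ? ? ?] := hP v hv j.
    by have [->|->] : w = n \/ w = n.+1 by lia.
  rewrite [RHS]surjective_pairing; congr pair; apply: funext => j.
    rewrite iter_pent_b; last by move=> i l; apply: cn.
    rewrite !rhoE ?leqnn ?leqnSn // /nb.
    have [_ _ Pj Qj] := hP v hv j; have [Pj1 Qj1 _ _] := hP v hv (j + 1).
    have cj := cn 0%N (j + 1) isT; rewrite /= in cj.
    by rewrite /=; field; rewrite Pj1 Qj1 Qj cj.
  rewrite iter_pent_c; last by move=> i l; apply: cn.
  rewrite !rhoE ?leqnn ?leqnSn // /nc.
  have [Pn Qn Pj Qj] := hP v hv j.
  by field; rewrite Pn Qn Qj.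
have c1 := FE B UB; rewrite E in c1.
apply: (coords_proj_equiv _ c1 (coords_iter cB okB)) => m hm; apply: has_parityP.
by rewrite (_ : odd `|_|%N = odd n.+1) //; lia.
Qed.

End Main.

Unset Implicit Arguments.
Theorem corollary4p8 (R : realType) (n : nat) (S : set int) :
  odd n ->
  (S `<` [set i : int | 1 <= i <= n%:Z])%classic ->
  generic n (X_set (R := R) n S) (fun A => nonsingular n n.+1 A).
Proof.
move=> nodd [SI /existsNP [i0 /not_implyP [i0n Si0]]].
pose j0 := i0 - 2.
(* d is 2 at the indices congruent to j0 modulo n, and 0 elsewhere *)
pose z0 : (int -> R) * (int -> R) :=
  (fun=> 1, fun j => if (n%:Z %| j - 1 - j0)%Z then 1 else -1).
have two : 1 + 1 != 0 :> R by rewrite -(natrD _ 1 1) pnatr_eq0.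
have dP i : (dsum z0.1 z0.2 i != 0) = (n%:Z %| i - j0)%Z.
  rewrite /dsum /= addrK; case: ifP => _; first by rewrite two.
  by rewrite subrr eqxx.
have nz : nondeg n z0.
  split=> j //=; rewrite ?oner_neq0 //.
    rewrite (_ : j + n%:Z - 1 - j0 = j - 1 - j0 + n%:Z); last by lia.
    by rewrite rpredDr //; exact: dvdzz.
  by case: ifP => _; rewrite ?oppr_eq0 oner_neq0.
have /boolp.choice [pq pqE] : forall wj : nat * int,
  exists pq : {mpoly R[2 * n]} * {mpoly R[2 * n]},
    (n <= wj.1 <= n.+1)%N -> [/\ pq.1.@[xv z0] != 0, pq.2.@[xv z0] != 0 &
      forall v, regular_upto wj.1 (zv (odd_gt0 nodd) v) ->
        rho (zv (odd_gt0 nodd) v) wj.1 wj.2 * pq.2.@[v] = pq.1.@[v]].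
  move=> [w j] /=; have [wn|nw] := boolP (n <= w <= n.+1)%N; last by exists (0, 0).
  have [|pq pqE] := @rho_rational R n nodd z0 j0 w j nz dP; first by lia.
  by exists pq.
pose p w j := (pq (w, j)).1; pose q w j := (pq (w, j)).2.
exists (principal_open (corner_minors p q)); split.
- exact: principal_openP.
- apply: (@principal_open_dense R n nodd S (corner_minors p q) z0 nz).
    rewrite rmorph_prod /=; apply/prodf_neq0 => j _.
    have [? ? _] := pqE (n, j%:Z) ltac:(simpl; lia);
      have [? ? _] := pqE (n.+1, j%:Z) ltac:(simpl; lia).
    by rewrite !mevalM !mulf_neq0.
  move=> i Si; apply/eqP; rewrite -[_ == 0]negbK dP /j0.
  have := SI i Si => /= i1; apply/negP.
  rewrite /= in i0n.
  rewrite (_ : i - 2 - (i0 - 2) = i - i0); last by lia.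
  move=> /dvdz_small dv; have ii : i - i0 = 0 by apply: dv; lia.
  by apply: Si0; rewrite (_ : i0 = i) //; lia.
move=> A [UA _]; apply: (@nonsingular_corner_minors R n nodd p q A UA) => w j v wn ok.
by have [_ _ E] := pqE (w, j) wn; apply: E.
Qed.
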